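(* Let $\overline\alpha$ be coherent. The following are equivalent: (1) $\overline\alpha$ is rational; (2) every model $\mathfrak M\models S_{\overline\alpha}$ embeds isomorphically into an atomic model of $S_{\overline\alpha}$.
   Context: Fix a finite relational language $L$ in which every relation symbol has arity at least $2$. $K_L$ is the class of all finite $L$-structures (including the empty one) in which every relation symbol is interpreted symmetrically and irreflexively. Fix $\overline\alpha:L\to(0,1]$, writing $\overline\alpha_E=\overline\alpha(E)$, such that it is not the case that all symbols of $L$ are binary and $\overline\alpha_E=1$ for all $E$. For $\mathfrak A\in K_L$ let $N_E(\mathfrak A)$ be the number of subsets of $A$ on which $E$ holds and $\delta(\mathfrak A)=|A|-\sum_{E}\overline\alpha_E N_E(\mathfrak A)$. $K_{\overline\alpha}=\{\mathfrak A\in K_L:\delta(\mathfrak A')\ge0\text{ for all substructures }\mathfrak A'\subseteq\mathfrak A\}$. For $\mathfrak A\subseteq\mathfrak B$ in $K_L$, $\mathfrak A\le\mathfrak B$ means $\delta(\mathfrak A)\le\delta(\mathfrak A')$ for all $\mathfrak A\subseteq\mathfrak A'\subseteq\mathfrak B$. $S_{\overline\alpha}$ is the theory whose models $\mathfrak M$ are those in which every finite substructure lies in $K_{\overline\alpha}$ and, for all $\mathfrak A\le\mathfrak B$ in $K_{\overline\alpha}$, every embedding $\mathfrak A\to\mathfrak M$ extends to an embedding $\mathfrak B\to\mathfrak M$. $\overline\alpha$ is coherent if there are positive integers $m_E$ ($E\in L$) with $\sum_{E}m_E\overline\alpha_E\in\mathbb Q$; $\overline\alpha$ is rational if every $\overline\alpha_E$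 is rational. *)

(* Defs.v *)
From HB Require Import structures.
From mathcomp Require Import all_boot all_order all_algebra.
From mathcomp Require Import finmap.
From mathcomp Require Import reals.
Set Implicit Arguments. Unset Strict Implicit. Unset Printing Implicit Defensive.
Import Order.TTheory GRing.Theory Num.Theory.
Local Open Scope fset_scope.
Local Open Scope ring_scope.

(* A relational language: a finite type of symbols [L] with arities [ar].
   An L-structure: a carrier (a choiceType; classically no loss of generality)
   and, for each symbol E, a boolean relation on finite sequences of elements
   (only sequences of length [ar E] are meant to satisfy it; this is part of
   membership in K_L below). *)
Record struc (L : finType) := Struc {
  car : choiceType;
  rel : L -> seq car -> bool }.

Section Defs.
Variables (L : finType) (ar : L -> nat) (R : realType) (alpha : L -> R).

Definition in_KL (M : struc L) (X : {fset car M}) : Prop :=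
  forall (E : L) (s : seq (car M)), all (fun x => x \in X) s -> rel E s ->
    [/\ size s = ar E, uniq s & forall t, perm_eq s t -> rel E t].

(* E holds on the finite set S (for symmetric relations the enumeration
   order is irrelevant) *)
Definition holds_on (M : struc L) (E : L) (S : {fset car M}) : bool :=
  (#|` S| == ar E)%N && rel E (enum_fset S).

Definition NE (M : struc L) (E : L) (X : {fset car M}) : nat :=
  #|` [fset S in fpowerset X | holds_on E S]|.

Definition delta (M : struc L) (X : {fset car M}) : R :=
  (#|` X|)%:R - \sum_(E : L) alpha E * (NE E X)%:R.

Definition in_Kalpha (M : struc L) (X : {fset car M}) : Prop :=
  in_KL X /\ forall Y : {fset car M}, Y `<=` X -> 0 <= delta Y.

Definition strong (M : struc L) (A B : {fset car M}) : Prop :=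
  A `<=` B /\ forall X : {fset car M}, A `<=` X -> X `<=` B -> delta A <= delta X.

Definition fin_embedding (N M : struc L) (A : {fset car N}) (f : A -> car M) : Prop :=
  injective f /\
  forall (E : L) (s : seq A), rel E (map val s) = rel E (map f s).

Definition model_S (M : struc L) : Prop :=
  (forall X : {fset car M}, in_Kalpha X) /\
  forall (N : struc L) (A B : {fset car N}) (sAB : A `<=` B),
    in_Kalpha B -> strong A B ->
    forall f : A -> car M, fin_embedding f ->
    exists g : B -> car M, fin_embedding g /\ forall a : A, g (fincl sAB a) = f a.

End Defs.

Section FO.
Variable (L : finType).

Inductive form : Type :=
  | FEq : nat -> nat -> form
  | FRel : L -> seq nat -> form
  | FNot : form -> form
  | FAnd : form -> form -> form
  | FEx : nat -> form -> form.

Fixpoint fv (f : form) : seq nat :=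
  match f with
  | FEq i j => [:: i; j]
  | FRel _ vs => vs
  | FNot g => fv g
  | FAnd g h => fv g ++ fv h
  | FEx i g => filter (fun k => k != i) (fv g)
  end.

Definition upd (T : Type) (v : nat -> T) (i : nat) (x : T) : nat -> T :=
  fun k => if k == i then x else v k.

Fixpoint sat (M : struc L) (v : nat -> car M) (f : form) : Prop :=
  match f with
  | FEq i j => v i = v j
  | FRel E vs => rel E (map v vs)
  | FNot g => ~ sat v g
  | FAnd g h => sat v g /\ sat v h
  | FEx i g => exists x : car M, sat (upd v i x) g
  end.

Definition form_in (n : nat) (f : form) : bool := all (fun k => (k < n)%N) (fv f).

(* M is atomic: for every n-tuple (given as values of x_0..x_(n-1) under v),
   its complete type (in Th(M)) is isolated by some formula phi. *)
Definition atomic (M : struc L) : Prop :=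
  forall (n : nat) (v : nat -> car M),
    exists phi : form, form_in n phi /\ sat v phi /\
      forall psi : form, form_in n psi -> sat v psi ->
        forall w : nat -> car M, sat w phi -> sat w psi.

Definition embedding (M N : struc L) (f : car M -> car N) : Prop :=
  injective f /\ forall (E : L) (s : seq (car M)), rel E s = rel E (map f s).

End FO.

Definition coherent (L : finType) (R : realType) (alpha : L -> R) : Prop :=
  exists m : L -> nat, (forall E, (0 < m E)%N) /\
    exists q : rat, \sum_(E : L) (m E)%:R * alpha E = ratr q.

Definition rational_alpha (L : finType) (R : realType) (alpha : L -> R) : Prop :=
  forall E : L, exists q : rat, alpha E = ratr q.

(* Main.v *)
(* A set of rank 0 is strong in every structure of the class, so if every
   finite subset of a model lies in a finite subset of rank 0, then the
   isomorphisms between subsets of rank 0 form a back-and-forth system, and the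
   existential diagrams of these subsets isolate types.

   All extensions are obtained by freely gluing finite pieces.  The basic piece
   is a path of new points, each joined by one edge to its predecessor and by
   as many others as the weight allows to the base: over a base X it has rank
   -g, while a proper part of the piece together with any part of X has
   nonnegative relative rank.  If alpha is rational, ranks are discrete and
   pieces can be composed so that the drop of rank is exactly the least rank of
   a set containing X.  A maximal family of gluings over a given model thus
   produces a model in which every finite set is contained in one of rank 0.

   If alpha(E) is irrational, g can be made arbitrarily small for a fixed number
   of base points.  For each eta in 2^omega, glue to a copy of the base a fan of
   pieces whose drops g are governed by eta and add up to the rank of the base.
   In every structure of the class containing it, such a fan is strong, so that
   the drops of the pieces realised over the base are those of the fan, and the
   type of the base determines eta.  An atomic model containing all fans
   would realise uncountably many types, each of them isolated by one of
   countably many formulas. *)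
Require Import Defs.
From HB Require Import structures.
From mathcomp Require Import all_boot all_order all_algebra.
From mathcomp Require Import finmap.
From mathcomp Require Import boolp classical_sets reals.
From mathcomp Require Import zify ring lra.
Set Implicit Arguments.
Unset Strict Implicit.
Unset Printing Implicit Defensive.
Import Order.TTheory GRing.Theory Num.Theory Defs.
Local Open Scope fset_scope.
Local Open Scope ring_scope.

(** One criterion governs all gluings: a piece that drops the rank by at most x, and only over its
    whole base, may be added as soon as every set containing the base has rank at least x. Strong
    extensions are the case x = 0, so a family maximal for this criterion yields a model and is also
    closed under every affordable drop.

    On the path, the first i points own about i / alpha(E) edges, rounded down, so that initial
    segments never drop; the final count is rounded up and the drop is the excess. A segment that
    starts after a gap loses an edge, and this edge pays for the drop if the path stops where the
    excess is least so far. For alpha(E) = p/q that excess is 1/q; for irrational alpha(E) Euclid's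
    algorithm makes it small.

    In the rational case the rank to cancel need not be a multiple of 1/q for the symbol carrying
    the paths: free points and disjoint edges of all symbols are added beforehand to make the
    deficit an integer. In the irrational case the drops of a fan approach the rank of the base
    without attaining it, and submodularity leaves no room for a foreign drop. *)

Definition fs (T : choiceType) (s : seq T) : {fset T} := [fset x in s].

Lemma in_fs (T : choiceType) (s : seq T) : fs s =i s.
Proof. by move=> x; rewrite in_fset. Qed.

(** * Rank functions *)

Section Rank.
Variables (L : finType) (ar : L -> nat) (R : realType) (alpha : L -> R).
Hypothesis alpha_ge0 : forall E, 0 <= alpha E.

Lemma enum_fsetK (T : choiceType) (S : {fset T}) : fs (enum_fset S) = S.
Proof. by apply/fsetP=> x; rewrite in_fs. Qed.

Lemma perm_enum_fset (T : choiceType) (s : seq T) :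
  uniq s -> perm_eq (enum_fset (fs s)) s.
Proof.
by move=> us; apply: uniq_perm => [||x]; rewrite ?fset_uniq // in_fs.
Qed.

Lemma perm_enum_imfset (T T' : choiceType) (f : T -> T') (S : {fset T}) :
  injective f -> perm_eq (enum_fset (f @` S)) (map f (enum_fset S)).
Proof.
move=> fI; apply: uniq_perm; rewrite ?fset_uniq // ?map_inj_uniq ?fset_uniq //.
by move=> x; apply/imfsetP/mapP => -[y yS ->]; exists y.
Qed.

Lemma rel_holds_on (M : struc L) (X : {fset car M}) E (s : seq (car M)) :
    in_KL ar X -> {subset s <= X} ->
  rel E s = uniq s && holds_on ar E (fs s).
Proof.
move=> HX sX; apply/idP/andP => [rs|[us /andP[_ r]]].
  have [szs us Hp] := HX E s (introT allP sX) rs; split=> //.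
  rewrite /holds_on card_fseq undup_id // szs eqxx /=.
  by apply: Hp; rewrite perm_sym perm_enum_fset.
have [|_ _ Hp] := HX E _ _ r.
  by apply/allP => x; rewrite in_fs => /sX.
exact/Hp/perm_enum_fset.
Qed.

Lemma card_imfset_inj (T T' : choiceType) (f : T -> T') (A : {fset T}) :
  injective f -> #|` f @` A| = #|` A|.
Proof. by move=> fI; apply: card_imfset. Qed.

Lemma fsubset_imfsetE (T T' : choiceType) (f : T -> T') (A : {fset T})
    (S : {fset T'}) :
  S `<=` f @` A -> exists2 S', S' `<=` A & S = f @` S'.
Proof.
move=> SA; exists [fset x in A | f x \in S]; first exact: fset_sub.
apply/fsetP => y; apply/idP/imfsetP => [yS|[x /= + ->]]; last first.
  by rewrite !inE => /andP[].
have /imfsetP[x /= xA yE] := fsubsetP SA _ yS.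
by exists x; rewrite // !inE xA -yE.
Qed.

Lemma imfset_inj (T T' : choiceType) (f : T -> T') :
  injective f -> injective (fun A : {fset T} => f @` A).
Proof.
move=> fI A B /fsetP AB; apply/fsetP => x.
by have := AB (f x); rewrite !(mem_imfset _ _ fI).
Qed.

Lemma imfset_fsubset (T T' : choiceType) (f : T -> T') (A B : {fset T}) :
  injective f -> (f @` A `<=` f @` B) = (A `<=` B).
Proof.
move=> fI; apply/fsubsetP/fsubsetP => AB x.
  by move=> xA; have := AB _ (in_imfset imfset_key f xA); rewrite mem_imfset.
by case/imfsetP=> y /= yA ->; rewrite mem_imfset //= AB.
Qed.

Lemma imfset_comp (T T' T'' : choiceType) (g : T' -> T'') (f : T -> T')
    (A : {fset T}) : (g \o f) @` A = g @` (f @` A).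
Proof.
apply/fsetP => z; apply/imfsetP/imfsetP => -[x /= xA ->].
  by exists (f x) => //; apply: in_imfset.
by case/imfsetP: xA => y yA ->; exists y.
Qed.

Lemma holds_on_embedding (M N : struc L) (f : car M -> car N) E S :
  embedding f -> in_KL ar (f @` S) -> holds_on ar E (f @` S) = holds_on ar E S.
Proof.
move=> [fI fr] HK; rewrite /holds_on card_imfset_inj //; congr andb.
have p := perm_enum_imfset S fI; rewrite fr.
have sub s : perm_eq s (enum_fset (f @` S)) -> all (fun x => x \in f @` S) s.
  by move=> ps; rewrite (perm_all _ ps); apply/allP.
apply/idP/idP => r.
  by have [|_ _ Hp] := HK E _ _ r; [exact: sub | exact: Hp].
have [|_ _ Hp] := HK E _ _ r; first by apply: sub; rewrite perm_sym.
by apply: Hp; rewrite perm_sym.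
Qed.

Lemma in_KL_sub (M : struc L) (X Y : {fset car M}) :
  Y `<=` X -> in_KL ar X -> in_KL ar Y.
Proof.
move=> /fsubsetP YX HX E s /allP sY; apply: HX; apply/allP => x /sY /YX //.
Qed.

Lemma NE_embedding (M N : struc L) (f : car M -> car N) E X :
  embedding f -> in_KL ar (f @` X) -> NE ar E (f @` X) = NE ar E X.
Proof.
move=> ef HK; have [fI _] := ef; rewrite /NE.
rewrite -(card_imfset_inj _ (imfset_inj fI)); congr #|` _|; apply/fsetP => S'.
apply/idP/imfsetP => [|[S /= + ->]]; rewrite !inE /= !fpowersetE => /andP[SX h].
  have [S SX' SE] := fsubset_imfsetE SX; exists S => //=.
  rewrite !inE /= fpowersetE SX' /= -(holds_on_embedding _ ef) -?SE //.
  exact: in_KL_sub HK.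
rewrite imfset_fsubset // SX /= holds_on_embedding //.
by apply: in_KL_sub HK; rewrite imfset_fsubset.
Qed.

Lemma delta_embedding (M N : struc L) (f : car M -> car N) X :
  embedding f -> in_KL ar (f @` X) -> delta ar alpha (f @` X) = delta ar alpha X.
Proof.
move=> ef HK; have [fI _] := ef; rewrite /delta card_imfset_inj //.
by congr (_ - _); apply: eq_bigr => E _; rewrite NE_embedding.
Qed.

Lemma NE_supermod (M : struc L) E (X Y : {fset car M}) :
  (NE ar E X + NE ar E Y <= NE ar E (X `|` Y) + NE ar E (X `&` Y))%N.
Proof.
rewrite /NE -cardfsUI.
apply: leq_add; apply: fsubset_leq_card; apply/fsubsetP => S;
  rewrite !inE /= !fpowersetE.
  by case/orP => /andP[h ->]; rewrite andbT (fsubset_trans h) // ?fsubsetUl ?fsubsetUr.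
by case/andP => /andP[h ->] /andP[h' _]; rewrite andbT fsubsetI h.
Qed.

Lemma delta_submod (M : struc L) (X Y : {fset car M}) :
  delta ar alpha (X `|` Y) + delta ar alpha (X `&` Y) <=
  delta ar alpha X + delta ar alpha Y.
Proof.
rewrite /delta.
suff : \sum_E alpha E * (NE ar E X)%:R + \sum_E alpha E * (NE ar E Y)%:R <=
       \sum_E alpha E * (NE ar E (X `|` Y))%:R +
       \sum_E alpha E * (NE ar E (X `&` Y))%:R.
  have : (#|` X `|` Y|%:R + #|` X `&` Y|%:R : R) = #|` X|%:R + #|` Y|%:R.
    by rewrite -!natrD cardfsUI.
  lra.
rewrite -!big_split /=; apply: ler_sum => E _; rewrite -!mulrDr -!natrD.
by rewrite ler_wpM2l // ler_nat NE_supermod.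
Qed.

End Rank.

(** * Free gluing *)

(* A point of a finite extension: [inl j] is the [j]-th point of the base and
   [inr k] is the [k]-th new point. *)
Definition pos := (nat + nat)%type.

(* [New c n D a k] is the [k]-th new point of the [c]-th copy of the extension of
   the tuple [a] by [n] points whose new edges are listed by [D]. *)
Inductive univ (L : finType) (T : Type) : Type :=
  | Base of T
  | New of nat & nat & (L -> {fset {fset pos}}) & seq (univ L T) & nat.

HB.instance Definition _ (L : finType) (T : Type) := gen_eqMixin (univ L T).
HB.instance Definition _ (L : finType) (T : Type) := gen_choiceMixin (univ L T).

(** The name of one gluing. [tcopy] allows the same extension to be glued repeatedly over the same
    tuple: this yields pieces with multiplicity, and pieces avoiding a given finite set. *)
Record task (L : finType) (T : Type) := Task {
  tcopy : nat;
  tnew : nat;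
  tdiag : L -> {fset {fset pos}};
  targs : seq (univ L T) }.

HB.instance Definition _ (L : finType) (T : Type) := gen_eqMixin (task L T).

Definition new_point (L : finType) (T : Type) (i : task L T) (k : nat) : univ L T :=
  New (tcopy i) (tnew i) (tdiag i) (targs i) k.

(** Points of a task rank above its arguments, so no two tasks can each have a point of the other
    among their arguments. *)
Fixpoint rank (L : finType) (T : Type) (u : univ L T) : nat :=
  match u with
  | Base _ => 0
  | New _ _ _ a _ => (foldr maxn 0 (map (@rank L T) a)).+1
  end.

(* [full] and [pre] below are locked so that [inE] leaves memberships in them alone. *)
Definition full (s n : nat) : {fset pos} :=
  locked (fs ([seq inl i | i <- iota 0 s] ++ [seq inr i | i <- iota 0 n])).

Lemma full_inl s n j : (inl j \in full s n) = (j < s)%N.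
Proof.
rewrite /full -lock in_fs mem_cat; apply/orP/idP => [[/mapP[x]|/mapP[x _ //]]|js].
  by rewrite mem_iota => /andP[_ xs] [->].
by left; apply: map_f; rewrite mem_iota.
Qed.

Lemma full_inr s n k : (inr k \in full s n) = (k < n)%N.
Proof.
rewrite /full -lock in_fs mem_cat; apply/orP/idP => [[/mapP[x _ //]|/mapP[x]]|kn].
  by rewrite mem_iota => /andP[_ xs] [->].
by right; apply: map_f; rewrite mem_iota.
Qed.

Definition full_in := (full_inl, full_inr).

Definition new_count (Y : {fset pos}) : nat :=
  #|` [fset p in Y | if p is inr _ then true else false]|.

Definition based (s : nat) (Y : {fset pos}) : bool := full s 0 `<=` Y.

Section Weight.
Variables (L : finType) (ar : L -> nat) (R : realType) (alpha : L -> R).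

Definition edge_count (D : L -> {fset {fset pos}}) (E : L) (Y : {fset pos}) : nat :=
  #|` [fset e in D E | e `<=` Y]|.

Definition edge_weight (D : L -> {fset {fset pos}}) (Y : {fset pos}) : R :=
  \sum_E alpha E * (edge_count D E Y)%:R.

(** A new point in every edge keeps the structure on the base unchanged and makes the task of an
    edge recoverable. *)
Definition wf_diag (s n : nat) (D : L -> {fset {fset pos}}) : Prop :=
  forall E e, e \in D E ->
    [/\ #|` e| = ar E, e `<=` full s n & exists k, inr k \in e].

(* The rank may drop (by at most [x]) only over the whole base. *)
Definition admissible (s n : nat) (D : L -> {fset {fset pos}}) (x : R) : Prop :=
  forall Y, Y `<=` full s n ->
    edge_weight D Y <= (new_count Y)%:R + (if based s Y then x else 0).

Section Struct.
Variable M : struc L.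
Notation U := (univ L (car M)).
Notation tk := (task L (car M)).

Lemma rank_new_point (i : tk) k u : u \in targs i -> (rank u < rank (new_point i k))%N.
Proof.
rewrite /new_point /= ltnS; elim: (targs i) => //= a l IH; rewrite inE.
by case/predU1P => [->|/IH h]; rewrite leq_max ?leqnn // h orbT.
Qed.

Lemma new_point_inj (i j : tk) k l : new_point i k = new_point j l -> i = j /\ k = l.
Proof. by case: i j => [a b c d] [a' b' c' d'] [] /= -> -> -> -> ->. Qed.

Definition pval (i : tk) (p : pos) : U :=
  match p with inl j => nth (new_point i 0) (targs i) j | inr k => new_point i k end.

Definition valid (i : tk) : Prop :=
  uniq (targs i) /\ wf_diag (size (targs i)) (tnew i) (tdiag i).

Definition edge (J : tk -> Prop) (E : L) (S : {fset U}) : Prop :=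
  (exists2 S0 : {fset car M}, holds_on ar E S0 & S = (@Base L (car M)) @` S0) \/
  (exists2 i, J i & exists2 e, e \in tdiag i E & S = (pval i) @` e).

(** Relations depend only on the set of entries, so symmetry and irreflexivity are built in. The
    carrier is all of [univ] whatever [J] is: ranks for different families are compared on the same
    finite sets, and points of absent tasks are merely isolated. *)
Definition glue (J : tk -> Prop) : struc L :=
  Struc (fun E (s : seq U) => uniq s && `[< edge J E (fs s) >]).

Definition all_valid (J : tk -> Prop) := forall i, J i -> valid i.

Lemma Base_inj : injective (@Base L (car M)).
Proof. by move=> x y []. Qed.

Lemma pval_inj i : valid i ->
  {in full (size (targs i)) (tnew i) &, injective (pval i)}.
Proof.
move=> [ua _] [j|k] [j'|k']; rewrite !full_in => h h' /=.
- by move/eqP; rewrite nth_uniq // => /eqP ->.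
- move=> e; have := rank_new_point k' (mem_nth (new_point i 0) h).
  by rewrite e ltnn.
- move=> e; have := rank_new_point k (mem_nth (new_point i 0) h').
  by rewrite e ltnn.
- by case/new_point_inj => _ ->.
Qed.

Lemma pval_imfset_inj i (e e' : {fset pos}) : valid i ->
  e `<=` full (size (targs i)) (tnew i) ->
  e' `<=` full (size (targs i)) (tnew i) ->
  pval i @` e = pval i @` e' -> e = e'.
Proof.
move=> vi; wlog suff sub : e e' / e `<=` full (size (targs i)) (tnew i) ->
  e' `<=` full (size (targs i)) (tnew i) ->
  pval i @` e = pval i @` e' -> e `<=` e'.
  by move=> h h' ee; apply/eqP; rewrite eqEfsubset sub // sub.
move=> /fsubsetP h /fsubsetP h' ee; apply/fsubsetP => p pe.
have : pval i p \in pval i @` e' by rewrite -ee in_imfset.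
by case/imfsetP => q /= qe' /pval_inj -> //; [exact: h|exact: h'].
Qed.

Lemma edge_card J E S : all_valid J -> edge J E S -> #|` S| = ar E.
Proof.
move=> oJ [[S0 /andP[/eqP <- _] ->]|[i Ji [e eD ->]]].
  by rewrite card_imfset_inj //; apply: Base_inj.
have [ua vD] := oJ _ Ji; have [<- ef _] := vD _ _ eD.
rewrite card_in_imfset //= => p q pe qe.
by apply: (pval_inj (oJ _ Ji)); apply: (fsubsetP ef).
Qed.

Lemma in_KL_glue J (X : {fset car (glue J)}) : all_valid J -> in_KL ar X.
Proof.
move=> oJ E s _ /andP[us /asboolP h]; split=> //.
  by rewrite -(edge_card oJ h) card_fseq undup_id.
move=> t pst /=; rewrite -(perm_uniq pst) us /=; apply/asboolP.
suff <- : fs s = fs t by [].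
by apply/fsetP => x; rewrite !in_fs (perm_mem pst).
Qed.

Lemma holds_on_glue J E (S : {fset U}) : all_valid J ->
  holds_on (M := glue J) ar E S = `[< edge J E S >].
Proof.
move=> oJ; rewrite /holds_on /= fset_uniq enum_fsetK /=.
by case: asboolP; rewrite ?andbF ?andbT // => /(edge_card oJ) ->; rewrite eqxx.
Qed.

Definition glue_delta (J : tk -> Prop) (Z : {fset U}) : R := delta ar alpha (M := glue J) Z.

Definition pre (i : tk) (Z : {fset U}) : {fset pos} :=
  locked [fset p in full (size (targs i)) (tnew i) | pval i p \in Z].

Lemma in_pre i Z p :
  (p \in pre i Z) = (p \in full (size (targs i)) (tnew i)) && (pval i p \in Z).
Proof. by rewrite /pre -lock inE /=. Qed.

Lemma pre_sub i Z : pre i Z `<=` full (size (targs i)) (tnew i).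
Proof. by rewrite /pre -lock fset_sub. Qed.

Lemma new_point_in_pval (i j : tk) k (e : {fset pos}) :
    e `<=` full (size (targs j)) (tnew j) ->
  new_point i k \in pval j @` e -> i = j \/ new_point i k \in targs j.
Proof.
move=> /fsubsetP ef /imfsetP[[l|l] /= le eE]; last by left; case/new_point_inj: eE.
by right; rewrite eE mem_nth //; have := ef _ le; rewrite full_in.
Qed.

(** If the edge came from another task [j], then a point of [i] would be an argument of [j] and a
    point of [j] an argument of [i], against [rank]. *)
Lemma edge_task (J : tk -> Prop) E (e : {fset pos}) (i : tk) k : all_valid J ->
    e `<=` full (size (targs i)) (tnew i) -> inr k \in e ->
    edge J E (pval i @` e) -> J i /\ e \in tdiag i E.
Proof.
move=> oJ ef ke.
have iS : new_point i k \in pval i @` e by apply: (in_imfset _ (pval i) ke).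
case=> [[S0 _ SE]|[j Jj [e' e'D SE]]].
  by move: iS; rewrite SE => /imfsetP[].
have [ua vD] := oJ _ Jj; have [_ e'f [l le']] := vD _ _ e'D.
have jS : new_point j l \in pval i @` e by rewrite SE; apply: (in_imfset _ (pval j) le').
have [ij|jai] := new_point_in_pval ef jS.
  rewrite ij in Jj SE e'f e'D; split=> //.
  by rewrite (pval_imfset_inj (oJ _ Jj) ef e'f SE).
rewrite SE in iS; have [ij|iaj] := new_point_in_pval e'f iS.
  by have := rank_new_point l jai; rewrite ij ltnn.
have := ltn_trans (rank_new_point k jai) (rank_new_point l iaj).
by rewrite ltnn.
Qed.

Definition add_one (J : tk -> Prop) (i : tk) : tk -> Prop := fun j => J j \/ j = i.

Lemma all_valid_add_one J i : all_valid J -> valid i -> all_valid (add_one J i).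
Proof. by move=> oJ vi j [/oJ//|->]. Qed.

Lemma NE_add_one J i E (Z : {fset U}) : all_valid J -> valid i -> ~ J i ->
  NE (M := glue (add_one J i)) ar E Z =
  (NE (M := glue J) ar E Z + edge_count (tdiag i) E (pre i Z))%N.
Proof.
move=> oJ vi nJi; have [ua vD] := vi.
have oJ' := all_valid_add_one oJ vi.
set A := [fset e in tdiag i E | e `<=` pre i Z].
have AI : {in A &, injective (fun e : {fset pos} => pval i @` e)}.
  move=> e e'; rewrite !inE /= => /andP[/vD[_ ef _] _] /andP[/vD[_ ef' _] _].
  exact: pval_imfset_inj.
rewrite /edge_count -/A -(card_in_imfset imfset_key AI) /NE.
set B := [fset S in _ | _]; set C := [fset S in _ | _].
set D := imfset _ _ _; have -> : B = C `|` D.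
  apply/fsetP => S; apply/idP/fsetUP; rewrite !inE /= !holds_on_glue // !fpowersetE.
    case/andP=> SZ /asboolP [h|[j Jj [e eD SE]]].
      by left; rewrite SZ; apply/asboolP; left.
    case: Jj => [Jj|ji].
      by left; rewrite SZ; apply/asboolP; right; exists j => //; exists e.
    right; rewrite ji in eD SE; apply/imfsetP; exists e => //.
    rewrite !inE /= eD; have [_ ef _] := vD _ _ eD.
    apply/fsubsetP => p pe; rewrite in_pre (fsubsetP ef) //=.
    by apply: (fsubsetP SZ); rewrite SE; apply: in_imfset.
  case=> [/andP[-> /asboolP h]|/imfsetP[e /= eA SE]].
    apply/asboolP; case: h => [h|[j Jj h]]; [by left|right; exists j => //].
    by left.
  move: eA; rewrite SE !inE /= => /andP[eD /fsubsetP ep]; apply/andP; split.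
    by apply/fsubsetP => z /imfsetP[p /= /ep]; rewrite in_pre => /andP[_ ?] ->.
  by apply/asboolP; right; exists i; [right|exists e].
rewrite cardfsU; suff -> : C `&` D = fset0 by rewrite cardfs0 subn0.
apply/fsetP => S; rewrite in_fset0; apply/negP => /fsetIP[].
rewrite !inE /= holds_on_glue // => /andP[_ /asboolP h] /imfsetP[e /= + SE].
rewrite !inE /= => /andP[/vD[_ ef [k ke]] _]; rewrite SE in h.
by have [] := edge_task oJ ef ke h.
Qed.

(** The points of [Z] are counted on both sides because the carrier is shared; only edges are
    gained, and by [edge_task] none of them was there before. *)
Lemma glue_delta_add_one J i (Z : {fset U}) : all_valid J -> valid i -> ~ J i ->
  glue_delta (add_one J i) Z = glue_delta J Z - edge_weight (tdiag i) (pre i Z).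
Proof.
move=> oJ vi nJi; rewrite /glue_delta /delta -addrA; congr (_ + _).
rewrite -opprD; congr (- _); rewrite -big_split /=; apply: eq_bigr => E _.
by rewrite -mulrDr -natrD NE_add_one.
Qed.

(** Every glued edge has a new point of its task, so a finite set sees only the tasks with a new
    point in it. This finite character reduces infinite families to finite ones. *)
Lemma eq_glue_delta J J' (Z : {fset U}) : all_valid J -> all_valid J' ->
    (forall i, (exists k, new_point i k \in Z) -> J i <-> J' i) ->
  glue_delta J Z = glue_delta J' Z.
Proof.
move=> oJ oJ' JJ; rewrite /glue_delta /delta; congr (_ - _); apply: eq_bigr => E _.
congr (_ * _%:R); rewrite /NE; congr #|` _|; apply/fsetP => S.
rewrite !inE /= !holds_on_glue // fpowersetE; case SZ : (S `<=` Z) => //=.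
apply: asbool_equiv_eq; split; case; [by left| |by left|].
  move=> [i Ji [e eD SE]]; right; exists i; last by exists e.
  apply/JJ => //; have [ua vD] := oJ _ Ji; have [_ _ [k ke]] := vD _ _ eD.
  by exists k; apply: (fsubsetP SZ); rewrite SE; apply: (in_imfset _ (pval i) ke).
move=> [i Ji [e eD SE]]; right; exists i; last by exists e.
apply/JJ => //; have [ua vD] := oJ' _ Ji; have [_ _ [k ke]] := vD _ _ eD.
by exists k; apply: (fsubsetP SZ); rewrite SE; apply: (in_imfset _ (pval i) ke).
Qed.

Lemma glue_delta_isolated J (P : pred U) (Z : {fset U}) : all_valid J ->
    (forall E S x, edge J E S -> x \in S -> ~~ P x) ->
  glue_delta J Z = glue_delta J [fset z in Z | ~~ P z] + #|` [fset z in Z | P z]|%:R.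
Proof.
move=> oJ HP; rewrite /glue_delta /delta.
have -> : #|` Z|%:R = #|` [fset z in Z | ~~ P z]|%:R + #|` [fset z in Z | P z]|%:R :> R.
  rewrite -natrD -cardfsUI; have -> : [fset z in Z | ~~ P z] `&` [fset z in Z | P z] = fset0.
    apply/fsetP => x; rewrite !inE /=; case: (x \in Z) => //=.
    by case: (P x).
  rewrite cardfs0 addn0; congr (#|` _|%:R); apply/fsetP => x; rewrite !inE /=.
  by case: (x \in Z) => //=; case: (P x).
rewrite -!addrA; congr (_ + _); rewrite addrC; congr (_ + _); congr (- _).
apply: eq_bigr => E _; congr (_ * _%:R); rewrite /NE; congr #|` _|; apply/fsetP => S.
rewrite !inE /= !holds_on_glue // !fpowersetE.
case: asboolP => h; rewrite ?andbF // !andbT; apply/fsubsetP/fsubsetP => sub x xS.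
  by rewrite !inE /= sub //=; apply: HP h xS.
by have := sub x xS; rewrite !inE /= => /andP[].
Qed.

End Struct.
End Weight.

(** * Maximal families of gluings *)

Section Maximal.
Variables (L : finType) (ar : L -> nat) (R : realType) (alpha : L -> R).
Variable M : struc L.
Notation U := (univ L (car M)).
Notation tk := (task L (car M)).
Notation glue_delta := (@glue_delta L ar R alpha M).
Notation all_valid := (@all_valid L ar M).
Notation valid := (@valid L ar M).
Notation edge := (@edge L ar M).

(* Points of tasks outside of [J] do not count as existing. *)
Definition dom (J : tk -> Prop) : pred U := fun u =>
  if u is New a b c d k then `[< J (Task a b c d) >] else true.

Lemma dom_new_point J i k : dom J (new_point i k) = `[< J i >].
Proof. by case: i. Qed.

Definition grounded (J : tk -> Prop) :=
  all_valid J /\ forall i u, J i -> u \in targs i -> dom J u.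

Definition hereditary (J : tk -> Prop) := forall Z : {fset U}, 0 <= glue_delta J Z.

Lemma edge_dom J E S x : grounded J -> edge J E S -> x \in S -> dom J x.
Proof.
move=> [oJ gJ] [[S0 _ ->]|[i Ji [e eD ->]]].
  by case/imfsetP=> y /= _ ->.
have [ua vD] := oJ _ Ji; have [_ /fsubsetP ef _] := vD _ _ eD.
case/imfsetP=> -[j|k] /= pe ->; last by rewrite dom_new_point; apply/asboolP.
by apply: gJ Ji _; apply: mem_nth; have := ef _ pe; rewrite full_in.
Qed.

Lemma new_count_pre i (Z : {fset U}) : valid i ->
  (new_count (pre i Z) <= #|` [fset z in Z | `[< exists k, z = new_point i k >]]|)%N.
Proof.
move=> vi; rewrite /new_count; set A := [fset p in _ | _].
have /card_in_imfsetP/eqP <- : {in A &, injective (pval i)}.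
  move=> p q; rewrite !inE /= => /andP[+ _] /andP[+ _].
  by rewrite !in_pre => /andP[pf _] /andP[qf _]; apply: (pval_inj vi).
apply: fsubset_leq_card; apply/fsubsetP => z /imfsetP[[l|l]] /=; rewrite !inE /= ?andbF //.
rewrite andbT in_pre => /andP[_ h] ->; rewrite h /=.
by apply/asboolP; exists l.
Qed.

Lemma based_pre i (Z : {fset U}) :
  based (size (targs i)) (pre i Z) -> {subset targs i <= Z}.
Proof.
move=> /fsubsetP b u ui; have iu : (index u (targs i) < size (targs i))%N.
  by rewrite index_mem.
have := b (inl (index u (targs i))); rewrite full_in iu => /(_ isT).
by rewrite in_pre /= nth_index // => /andP[].
Qed.

(** Split [Z] into the new points of [i], which are isolated before [i] is added, and the rest [W].
    Admissibility charges the new edges to the new points, except for [x] when all arguments lie in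
    [Z], hence in [W]; then the rank of [W] is at least [x]. *)
Lemma add_task J i x : grounded J -> hereditary J -> valid i ->
    (forall u, u \in targs i -> dom J u) ->
    admissible alpha (size (targs i)) (tnew i) (tdiag i) x ->
    (forall W : {fset U}, {subset targs i <= W} -> x <= glue_delta J W) ->
  ~ J i -> grounded (add_one J i) /\ hereditary (add_one J i).
Proof.
move=> [oJ gJ] hJ vi di ai hx nJi; split.
  split; first exact: all_valid_add_one.
  have sub u : dom J u -> dom (add_one J i) u.
    by case: u => //= a b c d k /asboolP h; apply/asboolP; left.
  by move=> j u [Jj|->] uj; apply: sub; [apply: gJ Jj uj|apply: di].
move=> Z; rewrite glue_delta_add_one //.
set P : pred U := fun z => `[< exists k, z = new_point i k >].
rewrite (@glue_delta_isolated _ ar _ alpha _ J P) //; last first.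
  move=> E S y eS yS; apply/asboolP => -[k yE].
  have := edge_dom (conj oJ gJ) eS yS; rewrite yE dom_new_point => /asboolP.
  exact: nJi.
have h1 := ai _ (pre_sub i Z).
have h2 : (new_count (pre i Z))%:R <= #|` [fset z in Z | P z]|%:R :> R.
  by rewrite ler_nat; apply: new_count_pre.
set W := [fset z in Z | ~~ P z].
have h3 : (if based (size (targs i)) (pre i Z) then x else 0) <= glue_delta J W.
  case: ifP => [/based_pre sub|_]; last exact: hJ.
  apply: hx => u ui; rewrite /W !inE /= sub //=; apply/asboolP => -[k uE].
  have := di _ ui; rewrite uE dom_new_point => /asboolP; exact: nJi.
lra.
Qed.

Definition saturated (J : tk -> Prop) := forall i x, valid i ->
    (forall u, u \in targs i -> dom J u) ->
    admissible alpha (size (targs i)) (tnew i) (tdiag i) x ->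
    (forall W : {fset U}, {subset targs i <= W} -> x <= glue_delta J W) ->
  J i.

(** Finitely many points name finitely many tasks, and a chain has one member containing all those
    that occur in its union. *)
Lemma chain_finite (F : set (set tk)) (r : seq U) : total_on F subset ->
    (exists X, F X) ->
  exists2 X, F X & forall i, (exists k, new_point i k \in r) ->
    (exists2 Y, F Y & Y i) -> X i.
Proof.
move=> tF [X0 FX0]; elim: r => [|u r [X FX HX]].
  by exists X0 => // i [k].
have [[i [k [uE [Y FY Yi]]]]|nu] :=
    pselect (exists i k, u = new_point i k /\ exists2 Y, F Y & Y i); last first.
  exists X => // i [k]; rewrite inE => /predU1P[ku|kr] HY; last by apply: HX; first exists k.
  by case: nu; exists i, k.
have [X' FX' [XX' YX']] : exists2 X', F X' & (X `<=` X')%classic /\ (Y `<=` X')%classic.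
  by have [h|h] := tF _ _ FX FY; [exists Y|exists X] => //; split.
exists X' => // j [l]; rewrite inE => /predU1P[+|lr] HY.
  by rewrite uE => /new_point_inj[-> _]; apply: YX'.
by apply: XX'; apply: HX => //; exists l.
Qed.

Lemma saturated_extension J0 : grounded J0 -> hereditary J0 ->
  exists J : tk -> Prop,
    [/\ forall i, J0 i -> J i, grounded J, hereditary J & saturated J].
Proof.
move=> [oJ0 gJ0] hJ0.
(* Zorn's lemma is also applied to the empty chain; with [J0] joined inside [P], that case is the
   hypothesis on [J0]. *)
pose P (J : set tk) := let J' := (fun i => J i \/ J0 i) in grounded J' /\ hereditary J'.
have PU J J' : (forall i, J i \/ J0 i <-> J' i) -> grounded J' -> hereditary J' -> P J.
  move=> e g h; rewrite /P /=; suff -> : (fun i => J i \/ J0 i) = J' by [].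
  by apply/funext => i; apply/propext.
have dom_sub (J J' : tk -> Prop) u : (forall i, J i -> J' i) -> dom J u -> dom J' u.
  by move=> s; case: u => //= a b c d k /asboolP h; apply/asboolP/s.
have [F FP tF|J [[gJ hJ] mJ]] := @Zorn_bigcup tk P.
  set J := (\bigcup_(X in F) X)%classic.
  have oJ : all_valid (fun i => J i \/ J0 i).
    move=> i [[X FX Xi]|/oJ0 //]; have [[oX _] _] := FP _ FX.
    by apply: oX; left.
  split; first split=> // i u [[X FX Xi]|Ji] ui.
  - have [[_ gX] _] := FP _ FX; apply: (dom_sub (fun i => X i \/ J0 i)).
      by move=> j [Xj|]; [left; exists X|right].
    by apply: gX ui; left.
  - by apply: (dom_sub J0); [move=> j; right|apply: gJ0 ui].
  move=> Z; have [nF|/forallNP eF] := pselect (exists X, F X); last first.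
    rewrite (@eq_glue_delta _ ar _ alpha _ _ J0) // => i _; split; [case=> // -[X FX]|by right].
    by case: (eF X).
  have [X FX HX] := @chain_finite F Z tF nF.
  have [[oX _] hX] := FP _ FX.
  rewrite (@eq_glue_delta _ ar _ alpha _ _ (fun i => X i \/ J0 i)) // => i Hk; split; last first.
    by case=> [Xi|]; [left; exists X|right].
  by case=> [[Y FY Yi]|]; [left; apply: HX => //; exists Y|right].
set J' := (fun i => J i \/ J0 i); exists J'; split=> //.
  by move=> i; right.
move=> i x vi di ai hx; have [//|nJi] := pselect (J' i).
have [g h] := add_task gJ hJ vi di ai hx nJi.
case: (mJ (add_one J' i)); last first.
  apply: (PU _ (add_one J' i)) => // j; split; [|by left].
  by case=> [//|]; left; right.
split; first by move=> j Jj; left; left.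
move=> sub; apply: nJi; left; apply: sub; by right.
Qed.

End Maximal.

Section Substructure.
Variables (L : finType) (ar : L -> nat) (R : realType) (alpha : L -> R).

Definition substr (M : struc L) (P : pred (car M)) : struc L :=
  Struc (fun E (s : seq {x : car M | P x}) => rel E (map val s)).

Lemma substr_embedding (M : struc L) (P : pred (car M)) :
  embedding (M := substr P) val.
Proof. by split; [apply: val_inj|]. Qed.

Lemma in_KL_embedding (M N : struc L) (f : car M -> car N) X :
  embedding f -> in_KL ar (f @` X) -> in_KL ar X.
Proof.
move=> [fI fr] HX E s sX rs.
have [||szs us Hp] := HX E (map f s).
- by apply/allP => _ /mapP[x /(allP sX) xX ->]; apply: in_imfset.
- by rewrite -fr.
split; [by rewrite -szs size_map|by rewrite -(map_inj_uniq fI)|].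
by move=> t st; rewrite fr; apply/Hp/perm_map.
Qed.

End Substructure.

(** * A saturated gluing is a model *)

Section Model.
Variables (L : finType) (ar : L -> nat) (R : realType) (alpha : L -> R).
Hypothesis alpha_ge0 : forall E, 0 <= alpha E.
Variable M : struc L.
Notation U := (univ L (car M)).
Notation tk := (task L (car M)).
Notation edge := (@edge L ar M).
Variable J : tk -> Prop.
Hypotheses (gJ : grounded ar J) (hJ : hereditary ar alpha J)
  (sJ : saturated ar alpha J).

Definition domain : struc L := substr (M := glue ar J) (dom J).

Lemma delta_domain (X : {fset car domain}) :
  delta ar alpha X = glue_delta ar alpha J (val @` X).
Proof.
rewrite /glue_delta (@delta_embedding _ ar _ alpha domain (glue ar J) val) //.
  exact: (@substr_embedding L (glue ar J)).
exact: in_KL_glue gJ.1.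
Qed.

Lemma domain_Kalpha (X : {fset car domain}) : in_Kalpha ar alpha X.
Proof.
split=> [|Y _]; last by rewrite delta_domain.
apply: (@in_KL_embedding _ ar domain (glue ar J) val).
  exact: (@substr_embedding L (glue ar J)).
exact: in_KL_glue gJ.1.
Qed.

Section Extension.
Variables (N : struc L) (A B : {fset car N}).
Hypotheses (sAB : A `<=` B) (HB : in_Kalpha ar alpha B) (HS : strong ar alpha A B).
Variable f : A -> car domain.
Hypothesis Hf : fin_embedding f.

Let args : seq U := [seq val (f x) | x <- fset_sub_enum A].
Let fresh := enum_fset (B `\` A).
Definition enc (x : car N) : pos :=
  if x \in A then inl (index x (enum_fset A)) else inr (index x fresh).
Definition ediag (E : L) : {fset {fset pos}} :=
  (fun S : {fset car N} => enc @` S) @`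
    [fset S in fpowerset B | holds_on ar E S && ~~ (S `<=` A)].
Let i : tk := Task 0 (size fresh) ediag args.

Let size_args : size args = #|` A|.
Proof. by rewrite size_map -(size_map val) val_fset_sub_enum. Qed.

Lemma enc_inj : {in B &, injective enc}.
Proof.
move=> x y xB yB; rewrite /enc; case: ifP => xA; case: ifP => yA // [].
  by apply: index_inj.
by apply: index_inj; rewrite ?inE /= ?xA ?yA.
Qed.

Lemma enc_full x : x \in B -> enc x \in full (size args) (size fresh).
Proof.
move=> xB; rewrite /enc size_args; case: ifP => xA; rewrite full_in.
  by rewrite index_mem.
by rewrite index_mem !inE xA.
Qed.

Lemma enc_imfset_full S : S `<=` B -> enc @` S `<=` full (size args) (size fresh).
Proof.
move=> /fsubsetP SB; apply/fsubsetP => _ /imfsetP[x /= xS ->].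
exact/enc_full/SB.
Qed.

Lemma enc_imfset_inj S S' : S `<=` B -> S' `<=` B -> enc @` S = enc @` S' -> S = S'.
Proof.
wlog suff sub : S S' / S `<=` B -> S' `<=` B -> enc @` S = enc @` S' -> S `<=` S'.
  by move=> h h' ee; apply/eqP; rewrite eqEfsubset sub // sub.
move=> /fsubsetP h /fsubsetP h' ee; apply/fsubsetP => x xS.
have : enc x \in enc @` S' by rewrite -ee in_imfset.
by case/imfsetP => y /= yS' /enc_inj -> //; [exact: h|exact: h'].
Qed.

Lemma ediagP E e : e \in ediag E ->
  exists S, [/\ S `<=` B, holds_on ar E S, ~~ (S `<=` A) & e = enc @` S].
Proof.
case/imfsetP => S /=; rewrite !inE /= fpowersetE => /and3P[SB h SA] ->.
by exists S.
Qed.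

Lemma ediagE E S : S `<=` B -> ~~ (S `<=` A) ->
  (enc @` S \in ediag E) = holds_on ar E S.
Proof.
move=> SB SA; apply/idP/idP => [/ediagP[S' [SB' h' _ /enc_imfset_inj ->//]]|h].
by apply/imfsetP; exists S => //=; rewrite !inE /= fpowersetE SB h SA.
Qed.

Lemma enc_inr S : S `<=` B -> ~~ (S `<=` A) -> exists k, inr k \in enc @` S.
Proof.
move=> SB /fsubsetPn[x xS xA]; exists (index x fresh).
by apply/imfsetP; exists x => //=; rewrite /enc (negbTE xA).
Qed.

Lemma ediag_valid : valid ar i.
Proof.
split.
  rewrite map_inj_uniq.
    by rewrite -(map_inj_uniq val_inj) val_fset_sub_enum fset_uniq.
  by move=> x y /val_inj; apply: Hf.1.
move=> E e /ediagP[S [SB h SA ->]]; split.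
- have /card_in_imfsetP/eqP -> : {in S &, injective enc}.
    by move=> x y xS yS; apply: enc_inj; apply: (fsubsetP SB).
  by case/andP: h => /eqP.
- exact: enc_imfset_full.
- exact: enc_inr.
Qed.

(** Decode the new points of [Y] and add all of [A]: this keeps the new points and can only add
    edges. Strongness of [A] in [B], applied to the resulting [Z], is then admissibility with drop
    0. *)
Lemma ediag_admissible : admissible alpha (size args) (size fresh) ediag 0.
Proof.
move=> Y Yf.
set Z := [fset x in B | (x \in A) || (enc x \in Y)].
have AZ : A `<=` Z by apply/fsubsetP => x xA; rewrite !inE /= xA (fsubsetP sAB).
have ZB : Z `<=` B by apply: fset_sub.
have := HS.2 _ AZ ZB; rewrite /delta.
have h1 : (#|` Z| <= #|` A| + new_count Y)%N.
  rewrite -(cardfsID A Z) (fsetIidPr AZ) leq_add2l /new_count.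
  have /card_in_imfsetP/eqP <- : {in Z `\` A &, injective enc}.
    move=> x y; rewrite !inE /= => /and3P[_ xB _] /and3P[_ yB _].
    exact: enc_inj.
  apply: fsubset_leq_card; apply/fsubsetP => _ /imfsetP[x /= + ->].
  rewrite !inE /= => /and3P[xA xB]; rewrite (negbTE xA) /= => ->.
  by rewrite /enc (negbTE xA).
have h2 E : (edge_count ediag E Y + NE ar E A <= NE ar E Z)%N.
  rewrite /edge_count /NE.
  set C := [fset e in _ | _]; set C1 := [fset S in _ | _]; set C2 := [fset S in _ | _].
  pose D := [fset S in C2 | ~~ (S `<=` A)].
  have hD : (#|` C| <= #|` D|)%N.
    apply: (@leq_trans #|` (fun S : {fset car N} => enc @` S) @` D|); last first.
      exact: leq_imfset_card.
    apply: fsubset_leq_card; apply/fsubsetP => e; rewrite !inE /= => /andP[eD eY].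
    have [S [SB h SA eS]] := ediagP eD; apply/imfsetP; exists S => //=.
    rewrite !inE /= fpowersetE h SA !andbT; apply/fsubsetP => x xS.
    rewrite !inE /= (fsubsetP SB) //=; apply/orP; right.
    by apply: (fsubsetP eY); rewrite eS; apply: in_imfset.
  have hC : D `&` C1 = fset0.
    apply/fsetP => S; rewrite !inE /= !fpowersetE.
    by case: (S `<=` A); rewrite ?andbF.
  have : (#|` D `|` C1| <= #|` C2|)%N.
    apply: fsubset_leq_card; apply/fsubsetP => S; rewrite !inE /= !fpowersetE.
    case/orP => [/andP[]//|/andP[SA ->]].
    by rewrite (fsubset_trans SA).
  rewrite cardfsU hC cardfs0 subn0; apply: leq_trans.
  by rewrite leq_add2r.
have h3 : edge_weight alpha ediag Y + \sum_E alpha E * (NE ar E A)%:R <=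
          \sum_E alpha E * (NE ar E Z)%:R.
  rewrite /edge_weight -big_split /=; apply: ler_sum => E _.
  by rewrite -mulrDr -natrD ler_wpM2l // ler_nat.
have : (#|` Z|%:R : R) <= #|` A|%:R + (new_count Y)%:R by rewrite -natrD ler_nat.
case: ifP; lra.
Qed.

Lemma ediag_in : J i.
Proof.
apply: (sJ ediag_valid _ ediag_admissible) => [u /mapP[x _ ->]|W _]; last exact: hJ.
exact: valP.
Qed.

Let h (x : car N) : U := pval i (enc x).

Let h_dom x : x \in B -> dom J (h x).
Proof.
move=> /enc_full; rewrite /h; case: (enc x) => [j|k]; rewrite full_in => jk.
  apply: gJ.2 ediag_in _; exact: mem_nth.
by rewrite dom_new_point; apply/asboolP/ediag_in.
Qed.

Let h_inj : {in B &, injective h}.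
Proof.
move=> x y xB yB /(pval_inj ediag_valid); rewrite !enc_full // => /(_ isT isT).
exact: enc_inj.
Qed.

Let h_old (x : A) : h (val x) = val (f x).
Proof.
have xA : val x \in A := valP x.
rewrite /h /enc xA /= (nth_map x); last first.
  by rewrite -(size_map val) val_fset_sub_enum index_mem.
congr (val (f _)); apply: val_inj; rewrite -(nth_map _ (val x)) //.
  by rewrite val_fset_sub_enum nth_index.
by rewrite -(size_map val) val_fset_sub_enum index_mem.
Qed.

Let h_edge E S : S `<=` B -> holds_on ar E S = `[< edge J E (h @` S) >].
Proof.
(* A set not inside [A] has a new point, so [edge_task] decides its edges; a set inside [A] is
   handled by the embedding [f]. *)
move=> SB; have [SA|SA] := boolP (S `<=` A); last first.
  have hS : h @` S = pval i @` (enc @` S) by rewrite -imfset_comp.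
  rewrite -ediagE // hS; apply/idP/asboolP => [eD|].
    by right; exists i; [exact: ediag_in|exists (enc @` S)].
  have [k kS] := enc_inr SB SA.
  by move=> hE; have [] := @edge_task _ ar _ J E _ i k gJ.1 (enc_imfset_full SB) kS hE.
pose s := [seq x <- fset_sub_enum A | val x \in S].
have sS : map val s = [seq x <- enum_fset A | x \in S].
  by rewrite -val_fset_sub_enum filter_map.
have us : uniq (map val s) by rewrite sS filter_uniq.
have fsS : fs (map val s) = S.
  apply/fsetP => x; rewrite in_fs sS mem_filter.
  by case xS : (x \in S) => //=; rewrite (fsubsetP SA).
have := Hf.2 E s; rewrite (@rel_holds_on _ ar _ A); last 2 first.
- exact: in_KL_sub HB.1.
- by move=> x; rewrite sS mem_filter => /andP[].
rewrite us fsS /= => ->; rewrite -map_comp.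
have -> : [seq (val \o f) x | x <- s] = map h (map val s).
  by rewrite -map_comp; apply: eq_map => x /=; rewrite h_old.
rewrite map_inj_in_uniq ?us /=; last first.
  move=> x y; rewrite sS !mem_filter => /andP[xS _] /andP[yS _].
  by apply: h_inj; apply: (fsubsetP SB).
have mS x : (x \in S) = (x \in map val s) by rewrite -in_fs fsS.
congr `[< edge J E _ >]; apply/fsetP => u; rewrite in_fs.
by apply/mapP/imfsetP => -[x /= xs ->]; exists x => //=; rewrite ?mS // -mS.
Qed.

Lemma extend : exists g : B -> car domain,
  fin_embedding g /\ forall a : A, g (fincl sAB a) = f a.
Proof.
exists (fun b : B => exist (dom J) (h (val b)) (h_dom (valP b))).
split; last by move=> a; apply: val_inj; rewrite /= -h_old.
split=> [x y [/h_inj xy]|E s].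
  by apply: val_inj; apply: xy; apply: valP.
set s' := map val s.
have s'B : {subset s' <= B} by move=> _ /mapP[x _ ->]; apply: valP.
rewrite (@rel_holds_on _ ar _ B) ?HB.1 //=; last exact: HB.1.
rewrite -map_comp.
have -> : [seq (val \o (fun b : B => exist (dom J) (h (val b)) (h_dom (valP b)))) x
  | x <- s] = map h s' by rewrite -map_comp; apply: eq_map.
rewrite (@map_inj_in_uniq _ _ h); last by move=> x y xs ys; apply: h_inj; apply: s'B.
congr andb; rewrite h_edge; last by apply/fsubsetP => x; rewrite in_fs => /s'B.
congr `[< edge J E _ >]; apply/fsetP => u; rewrite in_fs.
by apply/imfsetP/mapP => -[x /= xs ->]; exists x => //=; rewrite ?in_fs // -in_fs.
Qed.

End Extension.

Lemma domain_model : model_S ar alpha domain.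
Proof.
split; first exact: domain_Kalpha.
move=> N A B sAB HB HS f Hf; exact: (extend sAB HB HS Hf).
Qed.

End Model.

(** * Atomicity from sets of rank 0 *)

Section Formulas.
Variable L : finType.

(** Closed, so that it adds no variable to [fv]; a valuation supplies the witness. *)
Definition FTrue : form L := FEx 0 (FEq L 0 0).
Definition conj (r : seq (form L)) : form L := foldr (@FAnd L) FTrue r.
Definition lit (b : bool) (f : form L) : form L := if b then f else FNot f.

Lemma sat_conj (M : struc L) (v : nat -> car M) (T : eqType) (r : seq T) (F : T -> form L) :
  sat v (conj (map F r)) <-> forall x, x \in r -> sat v (F x).
Proof.
elim: r => [|x r IH] /=; first by split=> // _; exists (v 0%N).
split=> [[h /IH hr] y /predU1P[->//|/hr]//|h].
split; first by apply: h; rewrite mem_head.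
by apply/IH => y yr; apply: h; rewrite inE yr orbT.
Qed.

Lemma sat_conj_cat (M : struc L) (v : nat -> car M) r r' :
  sat v (conj (r ++ r')) <-> sat v (conj r) /\ sat v (conj r').
Proof.
elim: r => [|x r IH] /=; first by split=> [|[]//]; split=> //; exists (v 0%N).
by split=> [[? /IH[]]|[[? ?] ?]]; do ?split=> //; apply/IH.
Qed.

Lemma sat_lit (M : struc L) (v : nat -> car M) b f :
  sat v (lit b f) <-> (sat v f <-> b).
Proof.
by case: b => /=; split=> [h|[h1 h2]]; [split|apply: h2|split=> // /h|move=> /h1].
Qed.

Lemma sat_foldr_FEx (M : struc L) (v : nat -> car M) f r :
  sat v (foldr (@FEx L) f r) <->
  exists2 w, (forall k, k \notin r -> w k = v k) & sat w f.
Proof.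
elim: r v => [|i r IH] v /=.
  split=> [h|[w wv]]; first by exists v.
  by have -> : w = v by apply/funext => k; apply: wv.
split=> [[x /IH[w wv wf]]|[w wv wf]].
  exists w => // k; rewrite inE negb_or => /andP[ki kr].
  by rewrite wv // /upd (negbTE ki).
exists (w i); apply/IH; exists w => // k kr; rewrite /upd; case: eqP => [->//|/eqP ki].
by apply: wv; rewrite inE negb_or ki.
Qed.

Lemma fv_foldr_FEx (f : form L) r k :
  k \in fv (foldr (@FEx L) f r) -> k \in fv f /\ k \notin r.
Proof.
elim: r => [|i r IH] //=; rewrite mem_filter => /andP[ki /IH[kf kr]].
by rewrite inE negb_or ki.
Qed.

Lemma fv_conj (T : eqType) (r : seq T) (F : T -> form L) k :
  k \in fv (conj (map F r)) -> exists2 x, x \in r & k \in fv (F x).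
Proof.
elim: r => [|x r IH] //=; rewrite mem_cat => /orP[kx|/IH[y yr ky]].
  by exists x; rewrite ?mem_head.
by exists y; rewrite // inE yr orbT.
Qed.

Lemma fv_conj_cat r r' : fv (conj (r ++ r')) = fv (conj r) ++ fv (conj r').
Proof. by elim: r => //= x r ->; rewrite catA. Qed.

Lemma fv_lit b f : fv (lit b f) = fv f.
Proof. by case: b. Qed.

Variable ar : L -> nat.

(** A finite conjunction because the language is finite and only tuples of length [ar E] are listed;
    in structures of the class no other length can satisfy [E]. *)
Definition qfdiag (M : struc L) (v : nat -> car M) (m : nat) : form L :=
  conj ([seq lit (v p.1 == v p.2) (FEq L p.1 p.2) |
           p <- [seq (i, j) | i <- iota 0 m, j <- iota 0 m]] ++
        [seq lit (rel (tag p) (map v (map val (tagged p : (ar (tag p)).-tuple 'I_m))))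
               (FRel (tag p) (map val (tagged p : (ar (tag p)).-tuple 'I_m))) |
           p <- enum {: {E : L & (ar E).-tuple 'I_m}}]).

Lemma sat_qfdiag (M : struc L) (v w : nat -> car M) m :
  sat w (qfdiag v m) <->
  (forall i j, (i < m)%N -> (j < m)%N -> w i = w j <-> v i = v j) /\
  (forall E t, size t = ar E -> all (fun k => k < m)%N t ->
     rel E (map w t) = rel E (map v t)).
Proof.
rewrite /qfdiag; split.
  move=> /sat_conj_cat[/sat_conj h1 /sat_conj h2]; split.
    move=> i j im jm; have := h1 (i, j).
    rewrite allpairs_f ?mem_iota // => /(_ isT) /sat_lit /= ->.
    by split=> [/eqP|->].
  move=> E t st tm.
  have [t' tt'] : exists t' : (ar E).-tuple 'I_m, t = map val t'.
    elim: t (ar E) st tm => [|x t IH] _ <- /=; first by exists [tuple].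
    case/andP=> xm /(IH _ erefl)[t' tE].
    by exists [tuple of Ordinal xm :: t']; rewrite /= -tE.
  have := h2 (Tagged (fun E => (ar E).-tuple 'I_m) t') (mem_enum _ _).
  by move=> /sat_lit /=; rewrite -tt' => h; apply/idP/idP => /h.
move=> [h1 h2]; apply/sat_conj_cat; split; apply/sat_conj.
  move=> _ /allpairsP[[i j] [/= im jm ->]] /=; apply/sat_lit => /=.
  rewrite !mem_iota /= in im jm; rewrite h1 //.
  by split=> [->|/eqP].
move=> [E t] _; apply/sat_lit => /=; rewrite h2 ?size_map ?size_tuple //.
by apply/allP => _ /mapP[x _ ->].
Qed.

Lemma fv_qfdiag (M : struc L) (v : nat -> car M) m k :
  k \in fv (qfdiag v m) -> (k < m)%N.
Proof.
rewrite fv_conj_cat mem_cat => /orP[] /fv_conj[p].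
  case/allpairsP => -[i j] [/= im jm ->] /=; rewrite fv_lit !inE.
  by move: im jm; rewrite !mem_iota => im jm /orP[] /eqP ->.
by case: p => E t _; rewrite fv_lit /= => /mapP[x _ ->].
Qed.

End Formulas.

Section Atomic.
Variables (L : finType) (ar : L -> nat) (R : realType) (alpha : L -> R).
Variable N : struc L.

Definition finstr (A : {fset car N}) : struc L :=
  Struc (fun E (s : seq A) => rel E (map val s)).

Lemma finstr_embedding A : embedding (M := finstr A) val.
Proof. by split=> //; apply: val_inj. Qed.

Hypotheses (HN : model_S ar alpha N).
Hypothesis zeroN : forall A : {fset car N}, exists2 B : {fset car N},
  A `<=` B & delta ar alpha B = 0.

(** The back-and-forth system. Rank 0 is what makes the domain [C] strong in every larger finite
    set. *)
Definition similar (v w : nat -> car N) (r : seq nat) :=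
  exists (C : {fset car N}) (f : C -> car N), [/\ fin_embedding f,
    delta ar alpha C = 0 &
    forall k, k \in r -> exists h : v k \in C, w k = f [` h]].

Lemma in_KLN (X : {fset car N}) : in_KL ar X.
Proof. exact: (HN.1 X).1. Qed.

Lemma similar_sym v w r : similar v w r -> similar w v r.
Proof.
move=> [C [f [ef dC hf]]]; pose T := fset_sub_enum C.
have inT x : x \in T by apply: mem_fset_sub_enum.
pose C' := f @` fs T; exists C'.
have H (y : C') : {x : C | f x = val y}.
  apply: cid; have /imfsetP[x _ xy] := valP y.
  by exists x.
have fH y : f (sval (H y)) = val y by case: (H y).
have Hf (x : C) (h : f x \in C') : sval (H [` h]) = x by apply: ef.1; rewrite fH.
exists (fun y => val (sval (H y))); split.
- split=> [x y /val_inj xy|E s]; first by apply: val_inj; rewrite -!fH xy.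
  have -> : [seq val (sval (H y)) | y <- s] = map val (map (fun y => sval (H y)) s).
    by rewrite -map_comp.
  by rewrite ef.2 -map_comp; congr (rel E _); apply: eq_map => y /=; rewrite fH.
- rewrite /C' (@delta_embedding _ ar _ alpha (finstr C) N f) //; last exact: in_KLN.
  rewrite -dC -(@delta_embedding _ ar _ alpha (finstr C) N val); last 2 first.
  + exact: finstr_embedding.
  + exact: in_KLN.
  congr (delta _ _ _); apply/fsetP => x; apply/imfsetP/idP => [[y _ ->]|xC].
    exact: valP.
  by exists [` xC] => //=; rewrite in_fs.
move=> k /hf[h wk].
have h' : w k \in C' by rewrite wk; apply/imfsetP; exists [` h]; rewrite ?in_fs.
exists h'; suff -> : sval (H [` h']) = [` h] by [].
by apply: ef.1; rewrite fH.
Qed.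

Lemma similar_sub v w r r' : {subset r' <= r} -> similar v w r -> similar v w r'.
Proof.
by move=> rr [C [f [ef dC hf]]]; exists C, f; split=> // k /rr /hf.
Qed.

(** Only the forth step is needed, negation being handled by [similar_sym]. For a witness [x],
    enlarge the domain with [x] to a set of rank 0; the old domain is strong in it, so the model
    extends the isomorphism. *)
Lemma similar_sat f v w : similar v w (fv f) -> sat v f -> sat w f.
Proof.
elim: f v w => [i j|E t|f IH|f IHf g IHg|i f IH] v w.
- move=> [C [f [ef dC hf]]] /= vij.
  have [|hi ->] := hf i; first by rewrite mem_head.
  have [|hj ->] := hf j; first by rewrite !inE eqxx orbT.
  by congr (f _); apply: val_inj.
- move=> [C [f [ef dC hf]]] /=.
  have [s [-> ->]] : exists s : seq C, map v t = map val s /\ map w t = map f s.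
    elim: t hf => [|k t IH] hf /=; first by exists [::].
    have [|s [-> ->]] := IH; first by move=> l lt; apply: hf; rewrite /= inE lt orbT.
    by have [|h ->] := hf k; [rewrite mem_head|exists ([` h] :: s)].
  by rewrite ef.2.
- by move=> /similar_sym sim /= nf fw; apply: nf; apply: IH sim fw.
- move=> sim /= [hf hg]; split; [apply: IHf hf|apply: IHg hg];
    by apply: similar_sub sim => k kf /=; rewrite mem_cat kf ?orbT.
move=> [C [g [eg dC hg]]] /= [x xf].
have [B sCB dB] := zeroN (x |` C).
have CB : C `<=` B by apply: fsubset_trans sCB; apply: fsubsetU1.
have xB : x \in B by apply: (fsubsetP sCB); apply: fset1U1.
have HS : strong ar alpha C B.
  split=> // X _ _; rewrite dC; exact: (HN.1 X).2 (fsubset_refl X).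
have [h [eh hgE]] := HN.2 N C B CB (HN.1 B) HS g eg.
exists (h [` xB]); apply: IH xf; exists B, h; split=> // k kf; rewrite /upd.
case: eqP => [_|/eqP ki]; first by exists xB.
have [|vC ->] := hg k; first by rewrite /= mem_filter ki.
exists (fsubsetP CB _ vC); rewrite -hgE; congr (h _); exact: val_inj.
Qed.

Lemma zero_atomic : atomic N.
Proof.
move=> n v; have [B AB dB] := zeroN (fs (map v (iota 0 n))).
have vB k : (k < n)%N -> v k \in B.
  by move=> kn; apply: (fsubsetP AB); rewrite in_fs map_f // mem_iota.
set b := enum_fset B; pose m := (n + size b)%N.
(* The variables from [n] to [m - 1] enumerate [B]. The tuple lies in [B], so the equalities in the
   diagram tie the first [n] variables to this enumeration. *)
pose v' k := if (n <= k < m)%N then nth (v 0%N) b (k - n) else v k.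
have v'b x : x \in B -> v' (n + index x b)%N = x.
  move=> xB; rewrite /v' leq_addr ltn_add2l index_mem xB /=.
  by rewrite addKn nth_index.
have v'n k : (k < n)%N -> v' k = v k by rewrite /v' ltnNge => /negbTE ->.
exists (foldr (@FEx L) (qfdiag ar v' m) (iota n (size b))); split.
  apply/allP => k /fv_foldr_FEx[/fv_qfdiag km]; rewrite mem_iota -/m km andbT.
  by rewrite -ltnNge.
split.
  apply/sat_foldr_FEx; exists v'; first by move=> k; rewrite mem_iota /v' => /negbTE ->.
  exact/sat_qfdiag.
move=> psi pn vpsi w /sat_foldr_FEx[w' w'w /sat_qfdiag[h1 h2]].
have w'n k : (k < n)%N -> w' k = w k.
  by move=> kn; apply: w'w; rewrite mem_iota leqNgt kn.
have bm x : x \in B -> (n + index x b < m)%N by move=> xB; rewrite ltn_add2l index_mem.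
apply: (similar_sat _ vpsi); exists B, (fun x : B => w' (n + index (val x) b)%N).
split=> //; last first.
  move=> k /(allP pn) kn; exists (vB _ kn); rewrite -w'n //=.
  apply/h1; rewrite ?bm ?vB //; first by rewrite (leq_trans kn) // leq_addr.
  by rewrite v'b ?vB // v'n.
split=> [x y /h1 e|E s].
  have := e (bm _ (valP x)) (bm _ (valP y)).
  by rewrite !v'b; [apply: val_inj|apply: valP|apply: valP].
pose t := [seq n + index (val x) b | x : B <- s]%N.
have -> : [seq w' (n + index (val x) b)%N | x <- s] = map w' t by rewrite -map_comp.
have -> : map val s = map v' t.
  by rewrite -map_comp; apply: eq_map => x /=; rewrite v'b // valP.
have [st|st] := eqVneq (size t) (ar E).
  rewrite h2 //; apply/allP => _ /mapP[x _ ->]; apply: bm; exact: valP.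
have nr (u : nat -> car N) : rel E (map u t) = false.
  apply/negP => r; have [|sz _ _] := @in_KLN (fs (map u t)) E _ _ r.
    by apply/allP => x; rewrite in_fs.
  by move: st; rewrite -sz size_map eqxx.
by rewrite !nr.
Qed.

End Atomic.

(** * Extensions of small negative rank *)

Section Path.
Variables (L : finType) (ar : L -> nat) (R : realType) (alpha : L -> R).

(** A minimal pair of drop [x] that is minimal in the base too: omitting any point, old or new,
    destroys the drop. *)
Definition minext (s n : nat) (D : L -> {fset {fset pos}}) (x : R) : Prop :=
  [/\ wf_diag ar s n D,
      forall Y, Y `<=` full s n -> Y != full s n -> edge_weight alpha D Y <= (new_count Y)%:R
    & edge_weight alpha D (full s n) = n%:R + x].

Variables (E0 : L) (s n : nat) (f : nat -> nat) (x : R).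
Let r := ar E0.
Let a := alpha E0.
Let c i := (f i.+1 - f i)%N.

Hypotheses (r2 : (2 <= r)%N) (a_gt0 : 0 < a) (n_gt0 : (0 < n)%N) (x_ge0 : 0 <= x).
Hypotheses (f0 : f 0 = 0%N) (f_lt : forall i, (i < n)%N -> (f i < f i.+1)%N).
Hypothesis f_ge0 : forall i, (i < n)%N -> 0 <= i%:R - a * (f i)%:R.
Hypothesis f_le : forall i, (i < n)%N -> i%:R - a * (f i)%:R + x <= a.
Hypothesis f_last : a * (f n)%:R = n%:R + x.
Hypothesis c_le : forall i, (i < n)%N -> (c i + r <= s)%N.
Hypothesis cover : (s <= f n - n)%N \/ (3 <= r)%N /\ (s < n)%N.

Lemma r_le_s : (r <= s)%N.
Proof. by apply: leq_trans (c_le n_gt0); rewrite leq_addl. Qed.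

(* The [m]-subset of [{0, ..., s - 1}] made of [0, ..., m - 2] and of a point
   that moves cyclically with [t]. *)
Definition window (m t : nat) : seq nat :=
  if m is m'.+1 then (m' + t %% (s - m'))%N :: iota 0 m' else [::].

Lemma size_window m t : size (window m t) = m.
Proof. by case: m => //= m; rewrite size_iota. Qed.

Lemma window_uniq m t : uniq (window m t).
Proof.
case: m => //= m; rewrite iota_uniq andbT mem_iota /= add0n ltnNge.
by rewrite leq_addr.
Qed.

Lemma window_lt m t j : (m <= s)%N -> j \in window m t -> (j < s)%N.
Proof.
case: m => //= m ms; rewrite inE => /predU1P[->|].
  by rewrite -ltn_subRL ltn_pmod // subn_gt0.
by rewrite mem_iota /= add0n => /ltn_trans; apply.
Qed.

Lemma window_inj m t t' : (0 < m <= s)%N ->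
  window m t =i window m t' -> t = t' %[mod s - m.-1].
Proof.
case: m => //= m ms h; have := h (m + t %% (s - m))%N.
rewrite !inE eqxx /= => /esym/predU1P[/addnI//|].
by rewrite mem_iota /= add0n ltnNge leq_addr.
Qed.

(* Vertex [i] owns [c i] edges: if [i > 0] one of them joins it to vertex
   [i - 1], and the others only meet the base. *)
Definition pedge (i k : nat) : seq pos :=
  if (k == 0%N) && (0 < i)%N then
    inr i :: inr i.-1 :: [seq inl j | j <- window r.-2 i]
  else inr i :: [seq inl j | j <- window r.-1 (f i - i + k)].

Definition pindex : seq (nat * nat) :=
  [seq (i, k) | i <- iota 0 n, k <- iota 0 (c i)].

Definition pdiag (E : L) : {fset {fset pos}} :=
  if E == E0 then fs [seq fs (pedge p.1 p.2) | p <- pindex] else fset0.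

Lemma mem_pindex i k : ((i, k) \in pindex) = (i < n)%N && (k < c i)%N.
Proof.
apply/allpairsPdep/andP => [[i' [k' []]]|[ni kc]].
  by rewrite !mem_iota /= !add0n => h1 h2 [-> ->].
by exists i, k; rewrite !mem_iota.
Qed.

Lemma mem_map_inl (l : seq nat) j : ((inl j : pos) \in map inl l) = (j \in l).
Proof. by rewrite mem_map // => ? ? []. Qed.

Lemma mem_map_inr (l : seq nat) j : ((inr j : pos) \in map inl l) = false.
Proof. by apply/negP => /mapP[]. Qed.

Lemma pedge_inr i k l : (inr l \in pedge i k) =
  (l == i) || [&& k == 0%N, (0 < i)%N & l == i.-1].
Proof.
rewrite /pedge; case: ifP => [/andP[-> ->]|h]; rewrite !inE mem_map_inr ?orbF //.
by rewrite andbA h orbF.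
Qed.

Lemma f_ge i : (i <= n)%N -> (i <= f i)%N.
Proof. by elim: i => // i IH ni; apply: leq_ltn_trans (IH (ltnW ni)) (f_lt ni). Qed.

Lemma pedge_valid i k : (i < n)%N ->
  [/\ uniq (pedge i k), size (pedge i k) = r & {subset pedge i k <= full s n}].
Proof.
move=> ni; have rs := r_le_s.
have uinl (l : seq nat) : uniq (map (inl : nat -> pos) l) = uniq l.
  by rewrite map_inj_uniq // => ? ? [].
rewrite /pedge; case: ifP => [/andP[_ i0]|_] /=; split.
- rewrite !inE !mem_map_inr uinl window_uniq !andbT orbF.
  by apply/eqP => -[]; lia.
- by rewrite size_map size_window; case: (r) r2 => [|[|]].
- move=> p; rewrite !inE => /or3P[/eqP->|/eqP->|/mapP[j]]; rewrite ?full_in //.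
    by apply: leq_ltn_trans ni; apply: leq_pred.
  move=> /window_lt js ->; rewrite full_in js //; lia.
- by rewrite mem_map_inr uinl window_uniq.
- by rewrite size_map size_window prednK //; case: (r) r2.
- move=> p; rewrite !inE => /orP[/eqP->|/mapP[j]]; rewrite ?full_in //.
  move=> /window_lt js ->; rewrite full_in js //; lia.
Qed.

(** The greatest new point of an edge is its owner. Two base-only edges of one owner have shifts
    that differ by less than the modulus of [window], thanks to [c_le]. *)
Lemma pedge_inj : {in pindex &, injective (fun p => fs (pedge p.1 p.2))}.
Proof.
have sub i k i' k' : pedge i k =i pedge i' k' -> (i <= i')%N.
  move=> h; have := h (inr i); rewrite !pedge_inr eqxx /= => /esym/orP[/eqP->//|].
  by move=> /and3P[_ _ /eqP->]; apply: leq_pred.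
move=> [i k] [i' k']; rewrite !mem_pindex => /andP[ni kc] /andP[_ kc'] /= /fsetP h.
have {}h : pedge i k =i pedge i' k' by move=> p; have := h p; rewrite !in_fs.
have ii : i = i'.
  by apply/eqP; rewrite eqn_leq (sub _ _ _ _ h) (sub i' k' i k).
rewrite -{i'}ii in kc' h *; congr (_, _).
have h' : (k == 0%N) && (0 < i)%N = (k' == 0%N) && (0 < i)%N.
  have := h (inr i.-1); rewrite !pedge_inr eqxx !andbT.
  case: (posnP i) => [->|i0]; rewrite ?andbF //=.
  by have -> : (i.-1 == i) = false by lia.
have := h; rewrite /pedge -h'; case: ifP => [/andP[/eqP k0 i0] _|nk hh].
  by move: h'; rewrite k0 i0 !andbT eqxx => /esym/eqP.
have rs := r_le_s; have cs := c_le ni.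
have : window r.-1 (f i - i + k) =i window r.-1 (f i - i + k').
  by move=> j; have := hh (inl j); rewrite !inE !mem_map_inl.
have rb : (0 < r.-1 <= s)%N.
  by rewrite -subn1 subn_gt0 r2 (leq_trans (leq_subr _ _) rs).
move=> /(window_inj rb)/eqP; rewrite eqn_modDl => /eqP.
by rewrite !modn_small //; clear -cs r2 kc kc'; lia.
Qed.

Lemma size_pindex : size pindex = f n.
Proof.
rewrite size_allpairs_dep sumnE big_map.
under eq_bigr do rewrite size_iota.
have -> : \sum_(j <- iota 0 n) c j = (\sum_(0 <= j < n) (f j.+1 - f j))%N.
  by rewrite /index_iota subn0.
elim: n f_lt => [|m IH] fl; first by rewrite big_geq.
rewrite big_nat_recr //= IH; last by move=> i im; apply: fl; apply: ltnW.
by rewrite subnKC // ltnW // fl.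
Qed.

Lemma edge_weight_pdiag Y : edge_weight alpha pdiag Y = a * (edge_count pdiag E0 Y)%:R.
Proof.
rewrite /edge_weight (bigD1 E0) //= big1 ?addr0 // => E nE.
rewrite /edge_count /pdiag (negbTE nE); have -> : [fset e in fset0 | e `<=` Y] = fset0 :> {fset {fset pos}}.
  by apply/fsetP => e; rewrite !inE.
by rewrite cardfs0 mulr0.
Qed.

Lemma pdiag_valid : wf_diag ar s n pdiag.
Proof.
move=> E e; rewrite /pdiag; case: eqP => [->|//]; rewrite in_fs.
case/mapP => -[i k]; rewrite mem_pindex => /andP[ni kc] -> /=.
have [u sz sub] := pedge_valid k ni; split.
- by rewrite /fs card_fseq undup_id.
- by apply/fsubsetP => p; rewrite in_fs => /sub.
- by exists i; rewrite in_fs pedge_inr eqxx.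
Qed.

Lemma edge_weight_pdiag_full : edge_weight alpha pdiag (full s n) = n%:R + x.
Proof.
rewrite edge_weight_pdiag -f_last; congr (_ * _%:R); rewrite /edge_count.
have -> : [fset e in pdiag E0 | e `<=` full s n] = pdiag E0.
  apply/fsetP => e; rewrite !inE /=; case eD : (e \in pdiag E0) => //=.
  by have [] := pdiag_valid eD.
rewrite /pdiag eqxx /fs card_fseq undup_id ?size_map ?size_pindex //.
rewrite map_inj_in_uniq; last exact: pedge_inj.
apply: allpairs_uniq_dep => [|i _|]; [exact: iota_uniq|exact: iota_uniq|].
by move=> [i k] [i' k'] _ _ /= [-> ->].
Qed.

(** The numbers [f i - i + k] count the edges with a single new point consecutively along the path,
    from 0 to [f n - n]: the path edges, which take [k = 0] for [i > 0], are skipped. Hence the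
    moving point of the window sweeps the base if [s <= f n - n]; otherwise the windows of the path
    edges do, as [s < n]. *)
Lemma pdiag_cover j : (j < s)%N ->
  exists i k, (i, k) \in pindex /\ inl j \in pedge i k.
Proof.
move=> js; have rs := r_le_s; case: cover => [sm|[r3 sn]]; last first.
  have [i [i0 ni ij]] : exists i, [/\ (0 < i)%N, (i < n)%N & j \in window r.-2 i].
    have -> : r.-2 = (r - 3).+1 by lia.
    have [jr|rj] := ltnP j (r - 3).
      by exists 1%N; rewrite inE mem_iota /= add0n jr orbT; split=> //; lia.
    have [je|jr] := eqVneq j (r - 3)%N.
      exists (s - (r - 3))%N; rewrite inE modnn addn0 je eqxx; split=> //; lia.
    exists (j - (r - 3))%N; rewrite inE modn_small; last lia.
    by rewrite subnKC // eqxx; split=> //; lia.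
  exists i, 0%N; rewrite mem_pindex ni subn_gt0 f_lt //; split=> //.
  by rewrite /pedge i0 eqxx /= !inE mem_map_inl ij.
have [t [ts tj]] : exists t, (t <= s)%N /\ j \in window r.-1 t.
  have -> : r.-1 = (r - 2).+1 by lia.
  have [jr|rj] := ltnP j (r - 2).
    by exists 0%N; rewrite inE mem_iota /= add0n jr orbT.
  exists (j - (r - 2))%N; rewrite inE modn_small; last lia.
  by rewrite subnKC // eqxx; split=> //; lia.
have H b : (0 < b <= n)%N -> (t <= f b - b)%N -> exists i k,
    [/\ (i < b)%N, (k < c i)%N, (k == 0%N) && (0 < i)%N = false & (f i - i + k = t)%N].
  elim: b => // b IH /= bn tb.
  have [b0|b0] := posnP b.
    exists 0%N, t; rewrite andbF f0 /c f0; rewrite b0 in tb *; split=> //.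
    by have := f_lt n_gt0; rewrite f0; lia.
  have [tb'|bt] := leqP t (f b - b).
    have [|//|i [k [ib kc nl e]]] := IH; first by rewrite b0 ltnW.
    by exists i, k; split=> //; apply: ltnW.
  have fb := f_ge (ltnW bn); have flb := f_lt bn.
  exists b, (t - (f b - b))%N; rewrite /c b0 andbT; split=> //; lia.
have [||i [k [ni kc nl e]]] := H n; first by rewrite n_gt0 leqnn.
  exact: leq_trans sm.
exists i, k; rewrite mem_pindex ni kc; split=> //.
by rewrite /pedge nl inE e mem_map_inl tj.
Qed.

Section Sparse.
Variable Y : {fset pos}.
Hypothesis Yf : Y `<=` full s n.
Let S i : bool := inr i \in Y.
(** A bound for the edges owned by [i] inside [Y]: the path edge is lost when the predecessor is
    missing, and missing base points are ignored. *)
Let g i : nat := if S i then (c i - ((0 < i) && ~~ S i.-1))%N else 0%N.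

Lemma edge_count_pdiag_le :
  (edge_count pdiag E0 Y <= count (fun p => fs (pedge p.1 p.2) `<=` Y) pindex)%N.
Proof.
rewrite -size_filter; set q := [seq p <- _ | _].
apply: (@leq_trans #|` fs [seq fs (pedge p.1 p.2) | p <- q]|).
  apply: fsubset_leq_card; apply/fsubsetP => e; rewrite !inE /= /pdiag eqxx !in_fs.
  case/andP=> /mapP[p pp ->] pY; apply/mapP; exists p => //.
  by rewrite mem_filter pY.
by rewrite /fs card_fseq (leq_trans (size_undup _)) // size_map.
Qed.

Lemma count_pindex_le :
  (count (fun p => fs (pedge p.1 p.2) `<=` Y) pindex <= \sum_(0 <= i < n) g i)%N.
Proof.
rewrite /pindex count_flatten sumnE !big_map /index_iota subn0.
rewrite big_seq [X in (_ <= X)%N]big_seq; apply: leq_sum => i.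
rewrite mem_iota /= add0n => ni; rewrite count_map.
set P := preim _ _.
have Pinr k l : P k -> inr l \in pedge i k -> S l.
  by move=> /fsubsetP h le; apply: h; rewrite in_fs.
have PS k : P k -> S i by move=> /Pinr; apply; rewrite pedge_inr eqxx.
rewrite /g; case: ifP => [Si|nS]; last first.
  by rewrite leqNgt -has_count; apply/negP => /hasP[k _ /PS]; rewrite nS.
case: (boolP ((0 < i)%N && ~~ S i.-1)) => [/andP[i0 nS]|_]; last first.
  by rewrite subn0 -[X in (_ <= X)%N](size_iota 0) count_size.
have c0 : (0 < c i)%N by rewrite subn_gt0 f_lt.
have P0 : P 0%N = false.
  apply/negP => h; have := Pinr _ i.-1 h.
  by rewrite pedge_inr !eqxx i0 /= orbT (negbTE nS) => /(_ isT).
case: (c i) c0 => // m _.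
have -> : count P (iota 0 m.+1) = (P 0 + count P (iota 1 m))%N by [].
rewrite P0 add0n subn1 succnK.
by rewrite -[X in (_ <= X)%N](size_iota 1) count_size.
Qed.

Let l b : R := b%:R - a * (f b)%:R.
Let gap b := ~~ all S (iota 0 b).

(* [l b] is the weight that the first [b] points leave unused.  Entering a run of
   points of [Y] after a gap loses the edge to the missing point, whose weight
   [a] pays for [l b + x]. *)
Lemma charge b : (b <= n)%N ->
  a * (\sum_(0 <= i < b) g i)%:R +
    (if (b == 0%N) || S b.-1 then l b + (if gap b then x else 0) else 0)
  <= (\sum_(0 <= i < b) S i)%:R :> R.
Proof.
elim: b => [_|b IH bn].
  by rewrite !big_geq //= /l f0 mulr0 !subr0 !addr0.
have x0 : 0 <= x := x_ge0; have a0 : 0 < a := a_gt0.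
have {IH} := IH (ltnW bn); rewrite !big_nat_recr //= !natrD mulrDr.
set G := a * (\sum_(0 <= i < b) g i)%:R; set N : R := (\sum_(0 <= i < b) S i)%:R.
have gapS : gap b.+1 = gap b || ~~ S b.
  by rewrite /gap -addn1 iotaD all_cat /= add0n andbT negb_and.
rewrite gapS; have lb := f_ge0 bn; rewrite -/(l b) in lb.
have lx := f_le bn; rewrite -/(l b) in lx.
have lS : l b.+1 = l b + 1 - a * (c b)%:R.
  by rewrite /l /c natrB ?(ltnW (f_lt bn)) // -natr1; ring.
have cb : (0 < c b)%N by rewrite subn_gt0 f_lt.
rewrite {1}/g; case Sb : (S b) => /=; last first.
  rewrite mulr0 !addr0; case: (_ || _); case: (gap b); lra.
rewrite orbF lS; have [->|b0] := posnP b.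
  rewrite /gap /= subn0 /l f0; lra.
case Sb' : (S b.-1) => /=.
  rewrite subn0; lra.
have -> : gap b.
  by apply/allPn; exists b.-1; rewrite ?Sb' // mem_iota /= add0n prednK.
rewrite subn1 -[c b]prednK //= -natr1; lra.
Qed.

Lemma new_count_ge : (\sum_(0 <= i < n) S i <= new_count Y)%N.
Proof.
have -> : (\sum_(0 <= i < n) S i)%N = count S (iota 0 n).
  by rewrite -sum1_count [RHS]big_mkcond /index_iota subn0; apply: eq_bigr => i _; case: (S i).
rewrite -size_filter; set q := [seq i <- _ | _].
apply: (@leq_trans #|` fs (map (inr : nat -> pos) q)|).
  rewrite /fs card_fseq undup_id ?size_map //.
  by rewrite map_inj_uniq ?filter_uniq ?iota_uniq // => ? ? [].
apply: fsubset_leq_card; apply/fsubsetP => p; rewrite in_fs => /mapP[i].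
by rewrite mem_filter => /andP[Si _] ->; rewrite !inE /= andbT.
Qed.

Lemma pdiag_sparse : Y != full s n -> edge_weight alpha pdiag Y <= (new_count Y)%:R.
Proof.
move=> Yn; rewrite edge_weight_pdiag.
have h1 : (\sum_(0 <= i < n) S i)%:R <= (new_count Y)%:R :> R.
  by rewrite ler_nat new_count_ge.
have a0 := ltW a_gt0.
have ch := charge (leqnn n).
have [gn|] := boolP (gap n).
  have h2 : a * (edge_count pdiag E0 Y)%:R <= a * (\sum_(0 <= i < n) g i)%:R.
    rewrite ler_wpM2l // ler_nat; apply: leq_trans count_pindex_le.
    exact: edge_count_pdiag_le.
  apply: le_trans h2 _; apply: le_trans h1; apply: le_trans ch.
  rewrite gn; case: ifP => _; rewrite ?addr0 // /l f_last; lra.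
rewrite negbK => /allP aS.
have [j js jY] : exists2 j, (j < s)%N & inl j \notin Y.
  move: Yn; rewrite eqEfsubset Yf /= => /fsubsetPn[[j|i]]; rewrite full_in.
    by move=> js jY; exists j.
  by move=> ni; rewrite -/(S i) aS // mem_iota.
have [i [k [ikp jik]]] := pdiag_cover js.
have h2 : (edge_count pdiag E0 Y < f n)%N.
  apply: leq_ltn_trans edge_count_pdiag_le _; rewrite -size_pindex.
  rewrite ltn_neqAle count_size andbT -all_count; apply/allPn; exists (i, k) => //.
  by apply/negP => /fsubsetP/(_ (inl j)); rewrite in_fs => /(_ jik); apply/negP.
have h3 : (edge_count pdiag E0 Y)%:R + 1 <= (f n)%:R :> R by rewrite natr1 ler_nat.
have h4 : a * (edge_count pdiag E0 Y)%:R + a <= a * (f n)%:R.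
  by rewrite -[X in _ + X]mulr1 -mulrDr ler_wpM2l.
have h5 : (\sum_(0 <= i < n) S i)%N = n.
  rewrite big_nat (eq_bigr (fun=> 1%N)).
    by rewrite -big_nat sum_nat_const_nat muln1 subn0.
  by move=> i' /andP[_ ni']; rewrite aS // mem_iota.
have := f_le n_gt0; rewrite f0 mulr0 subr0 add0r.
move: h1; rewrite h5; have fl : a * (f n)%:R = n%:R + x := f_last; lra.
Qed.

End Sparse.

Lemma path_minext : exists D, minext s n D x.
Proof.
exists pdiag; split; [exact: pdiag_valid|exact: pdiag_sparse|exact: edge_weight_pdiag_full].
Qed.

End Path.

(** * Rational weights *)

Section Reach.
Variables (L : finType) (ar : L -> nat) (R : realType) (alpha : L -> R).
Hypothesis alpha_gt0 : forall E, 0 < alpha E.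
Hypothesis alpha_le1 : forall E, alpha E <= 1.
Hypothesis ar2 : forall E, (2 <= ar E)%N.

Lemma rational_minext (E0 : L) (p q : nat) : (0 < p <= q)%N -> coprime q p ->
    alpha E0 = p%:R / q%:R -> (3 <= ar E0)%N \/ (p < q)%N ->
  forall s, (q.+2 + ar E0 <= s)%N ->
    exists n D, minext ar alpha s n D (q%:R^-1).
Proof.
move=> /andP[p0 pq] cqp aE hr s hs.
have q0 : (0 < q)%N by apply: leq_trans pq.
have qR : 0 < q%:R :> R by rewrite ltr0n.
have [n0 pn0] : exists n0, (p %| n0 * q + 1)%N.
  exists (chinese q p 0 p.-1 %/ q)%N; set c := chinese _ _ _ _.
  have qc : (q %| c)%N by apply/eqP; rewrite /c chinese_modl // mod0n.
  rewrite divnK // /dvdn -modnDml chinese_modr // modnDml.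
  by rewrite addn1 prednK // modnn.
pose n := (n0 + p * s.+1)%N.
have pn : (p %| n * q + 1)%N.
  by rewrite mulnDl addnAC dvdn_addr // -mulnA dvdn_mulr.
have ns : (s < n)%N by rewrite /n; nia.
have n_gt0 : (0 < n)%N by apply: leq_ltn_trans ns.
pose m := ((n * q + 1) %/ p)%N; have mp : (m * p = n * q + 1)%N by rewrite divnK.
pose f i := if (i < n)%N then (i * q %/ p)%N else m.
have fi i : (i < n)%N -> f i = (i * q %/ p)%N by rewrite /f => ->.
have fn : f n = m by rewrite /f ltnn.
have f_lo i : (i < n)%N -> (f i * p <= i * q)%N.
  by move=> ni; rewrite fi // leq_trunc_div.
have f_hi i : (i < n)%N -> (i * q < (f i).+1 * p)%N.
  by move=> ni; rewrite fi // ltn_ceil.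
have f_lo' i : (i < n)%N -> (f i.+1 * p <= i.+1 * q + 1)%N.
  move=> ni; have [/f_lo h|ni'] := ltnP i.+1 n; first lia.
  have -> : i.+1 = n by lia.
  by rewrite fn mp.
have f_hi' i : (i < n)%N -> (i.+1 * q < (f i.+1).+1 * p)%N.
  move=> ni; have [/f_hi //|ni'] := ltnP i.+1 n.
  have -> : i.+1 = n by lia.
  by rewrite fn; nia.
have key i : (i < n)%N -> i%:R - alpha E0 * (f i)%:R = ((i * q)%:R - (f i * p)%:R) / q%:R.
  by move=> _; rewrite aE !natrM; field; rewrite lt0r_neq0.
exists n; apply: (@path_minext _ ar _ alpha E0 s n f) => //.
- by rewrite invr_ge0 ltW.
- by rewrite fi // mul0n div0n.
- by move=> i ni; have := f_hi' i ni; have := f_lo i ni; nia.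
- by move=> i ni; rewrite key // divr_ge0 ?(ltW qR) // subr_ge0 ler_nat f_lo.
- move=> i ni; rewrite key // aE -[X in _ + X <= _]mul1r -mulrDl ler_pM2r ?invr_gt0 //.
  have : ((i * q).+1%:R : R) <= ((f i).+1 * p)%:R by rewrite ler_nat f_hi.
  by rewrite mulSn natrD -natr1; lra.
- rewrite aE fn mulrAC -natrM mulnC mp natrD natrM; field; exact: lt0r_neq0.
- move=> i ni; have := f_hi i ni; have := f_lo' i ni; have := f_lo i ni; nia.
(* For a binary symbol of weight 1 only two edges would reach the base, whatever the length; this is
   the excluded case. *)
case: hr => [r3|pq']; [by right|left].
rewrite fn; have : (n * p + n <= m * p)%N by rewrite mp; nia.
have : (p * s.+1 <= n)%N by rewrite /n leq_addl.
nia.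
Qed.

(* [x] may be negative: such steps supply points and edges that make the final
   drop a multiple of the drop of a path. *)
Definition reach (s n : nat) (x : R) := exists D, [/\ wf_diag ar s n D,
  admissible alpha s n D (Num.max 0 x) & edge_weight alpha D (full s n) = n%:R + x].

Lemma new_count_full s n : new_count (full s n) = n.
Proof.
rewrite /new_count; have -> : [fset p in full s n | if p is inr _ then true else false] =
  fs (map (inr : nat -> pos) (iota 0 n)).
  apply/fsetP => p; rewrite [RHS]in_fs.
  have -> : (p \in [fset p in full s n | if p is inr _ then true else false]) =
    (p \in full s n) && (if p is inr _ then true else false) by rewrite inE.
  case: p => [j|k]; rewrite full_in ?andbF ?andbT.
    by apply/esym/negP => /mapP[].
  by rewrite mem_map ?mem_iota // => ? ? [].
by rewrite /fs card_fseq undup_id ?size_map ?size_iota // map_inj_uniq ?iota_uniq // => ? ? [].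
Qed.

Lemma based_full s n : based s (full s n).
Proof. by apply/fsubsetP => -[j|k]; rewrite !full_in. Qed.

Lemma minext_reach s n D x : 0 <= x -> minext ar alpha s n D x -> reach s n x.
Proof.
move=> x0 [vD sD wD]; exists D; split=> // Y Yf; rewrite max_r //.
have [->|Yn] := eqVneq Y (full s n); first by rewrite wD new_count_full based_full.
by apply: le_trans (sD _ Yf Yn) _; rewrite lerDl; case: ifP.
Qed.

Lemma reach0 s : reach s 0 0.
Proof.
have w0 Y : edge_weight alpha (fun _ : L => fset0) Y = 0.
  rewrite /edge_weight big1 // => E _; rewrite /edge_count.
  have -> : [fset e in fset0 | e `<=` Y] = fset0 :> {fset {fset pos}}.
    by apply/fsetP => e; rewrite !inE.
  by rewrite cardfs0 mulr0.
exists (fun _ => fset0); split=> [E e|Y _|]; rewrite ?in_fset0 ?w0 ?addr0 //.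
by rewrite maxxx; case: ifP; rewrite addr0 ler0n.
Qed.

(** The second extension has the whole first one as its base: its base points from [s] on are the
    new points of the first. *)
Definition relabel (s n : nat) (p : pos) : pos :=
  match p with
  | inl j => if (j < s)%N then inl j else inr (j - s)%N
  | inr k => inr (n + k)%N
  end.

Lemma relabel_inj s n n' : {in full (s + n) n' &, injective (relabel s n)}.
Proof.
move=> [j|k] [j'|k']; rewrite !full_in /= => h h'.
- by case: ltnP => js; case: ltnP => js' // [] e; congr inl; lia.
- by case: ltnP => js // [] e; lia.
- by case: ltnP => js // [] e; lia.
- by case=> /addnI ->.
Qed.

Lemma relabel_full s n n' p : p \in full (s + n) n' ->
  relabel s n p \in full s (n + n').
Proof.
case: p => [j|k]; rewrite full_in /= => h; last by rewrite full_in ltn_add2l.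
by case: ltnP => js; rewrite full_in //; lia.
Qed.

(** The side condition excludes x > 0 > x': there the first piece alone would drop by x, more than
    the composite is allowed to. So steps that raise the rank come before those that lower it. *)
Lemma reach_comp s n n' x x' : 0 <= x' \/ x <= 0 ->
  reach s n x -> reach (s + n) n' x' -> reach s (n + n') (x + x').
Proof.
move=> hx [D1 [v1 a1 w1]] [D2 [v2 a2 w2]].
pose rho := relabel s n.
have rinj := @relabel_inj s n n'.
pose D2' E := (fun e : {fset pos} => rho @` e) @` D2 E.
pose D E := D1 E `|` D2' E.
have D2'_inr E e : e \in D2' E -> exists k, inr (n + k)%N \in e.
  case/imfsetP => e' /= /v2[_ _ [k ke]] ->; exists k.
  exact: (in_imfset _ rho ke).
have rho_sub (e : {fset pos}) Y : e `<=` full (s + n) n' ->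
    (rho @` e `<=` Y) = (e `<=` [fset p in full (s + n) n' | rho p \in Y]).
  move=> /fsubsetP ef; apply/fsubsetP/fsubsetP => h p.
    by move=> pe; rewrite !inE /= ef //= h // in_imfset.
  by case/imfsetP => p' /= /h; rewrite !inE /= => /andP[_ +] ->.
have rho_einj : {in [pred e : {fset pos} | e `<=` full (s + n) n'] &,
    injective (fun e : {fset pos} => rho @` e)}.
  have sub e e' : e `<=` full (s + n) n' -> e' `<=` full (s + n) n' ->
      rho @` e = rho @` e' -> e `<=` e'.
    move=> /fsubsetP h /fsubsetP h' ee; apply/fsubsetP => p pe.
    have : rho p \in rho @` e' by rewrite -ee in_imfset.
    by case/imfsetP => p' /= pe' /rinj -> //; [exact: h|exact: h'].
  move=> e e'; rewrite !inE => h h' ee; apply/eqP.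
  by rewrite eqEfsubset (sub e e') // (sub e' e).
have wD Y : Y `<=` full s (n + n') -> edge_weight alpha D Y =
    edge_weight alpha D1 (Y `&` full s n) +
    edge_weight alpha D2 [fset p in full (s + n) n' | rho p \in Y].
  move=> Yf; rewrite /edge_weight -big_split /=; apply: eq_bigr => E _.
  rewrite -mulrDr -natrD; congr (_ * _%:R); rewrite /edge_count.
  set C1 := [fset e in D1 E | _]; set C2 := [fset e in D2 E | _].
  have /card_in_imfsetP/eqP <- : {in C2 &, injective (fun e : {fset pos} => rho @` e)}.
    move=> e e'; rewrite !inE /= => /andP[/v2[_ h _] _] /andP[/v2[_ h' _] _].
    exact: rho_einj.
  pose C2' := (fun e : {fset pos} => rho @` e) @` C2; rewrite -/C2'.
  have -> : [fset e in D E | e `<=` Y] = C1 `|` C2'.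
    apply/fsetP => e; rewrite !inE /= fsubsetI; apply/idP/orP.
      case/andP => /orP[eD|/imfsetP[e' /= e'D ->]] eY.
        by left; rewrite eD eY /=; have [] := v1 _ _ eD.
      right; apply/imfsetP; exists e' => //=; rewrite !inE /= e'D /=.
      by rewrite -rho_sub //; have [] := v2 _ _ e'D.
    case=> [/and3P[-> -> _] //|/imfsetP[e' /= + ->]].
    rewrite !inE /= => /andP[e'D]; rewrite -rho_sub; last by have [] := v2 _ _ e'D.
    by move=> ->; rewrite andbT (in_imfset _ (fun e : {fset pos} => rho @` e)) ?orbT.
  rewrite cardfsU; suff -> : C1 `&` C2' = fset0 by rewrite cardfs0 subn0.
  apply/fsetP => e; rewrite in_fset0; apply/negP => /fsetIP[].
  rewrite !inE /= => /andP[/v1[_ /fsubsetP ef _] _] /imfsetP[e' /= + ee'].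
  rewrite !inE /= => /andP[e'D _].
  have [k] : exists k, inr (n + k)%N \in e.
    by apply: (D2'_inr E); rewrite ee' (in_imfset _ (fun e : {fset pos} => rho @` e)).
  by move=> /ef; rewrite full_in; lia.
have nY Y : Y `<=` full s (n + n') -> new_count Y =
    (new_count (Y `&` full s n) + new_count [fset p in full (s + n) n' | rho p \in Y])%N.
  move=> /fsubsetP Yf; rewrite /new_count.
  set B1 := [fset p in Y `&` _ | _]; set B2 := [fset p in [fset p in _ | _] | _].
  have /card_in_imfsetP/eqP <- : {in B2 &, injective rho}.
    move=> p p'; rewrite !inE /= => /andP[/andP[h _] _] /andP[/andP[h' _] _].
    exact: rinj.
  set B := [fset p in Y | _].
  have -> : B = B1 `|` rho @` B2.
    apply/fsetP => -[j|k]; rewrite in_fsetU !inE /= ?andbF /=.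
      by apply/esym/negP => /imfsetP[[l|l]] /=; rewrite !inE /= ?andbF.
    rewrite !andbT; apply/idP/orP => [kY|[/andP[]//|]].
      rewrite kY /= full_in; have [kn|nk] := ltnP k n; [by left|right].
      have := Yf _ kY; rewrite full_in => kn'.
      apply/imfsetP; exists (inr (k - n)%N); last by rewrite /= subnKC.
      by rewrite /= !inE /= full_in subnKC // kY !andbT; lia.
    case/imfsetP => -[l|l] /=; rewrite !inE /= ?andbF //.
    by rewrite andbT => /andP[_ +] ->.
  rewrite cardfsU; suff -> : B1 `&` rho @` B2 = fset0 by rewrite cardfs0 subn0.
  apply/fsetP => p; rewrite in_fset0; apply/negP => /fsetIP[h1 /imfsetP[[l|l] /= h2 pE]].
    by move: h2; rewrite !inE /= andbF.
  by move: h1; rewrite pE !inE /= full_in => /andP[/andP[_]]; lia.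
exists D; split.
- move=> E e; rewrite /D in_fsetU => /orP[/v1[ce /fsubsetP ef ke]|].
    split=> //; apply/fsubsetP => -[j|k] /ef; rewrite !full_in //.
    by move=> h; rewrite ltn_addr.
  move=> eD; have [k kE] := D2'_inr _ _ eD; case/imfsetP: eD => e' /= /v2[ce ef _] ee.
  split; last by exists (n + k)%N.
    rewrite ee -ce; apply/eqP/card_in_imfsetP => p q pe qe.
    by apply: rinj; apply: (fsubsetP ef).
  rewrite ee; apply/fsubsetP => _ /imfsetP[p /= pe ->].
  exact/relabel_full/(fsubsetP ef).
- move=> Y Yf; rewrite wD // nY // natrD.
  set Y1 := Y `&` _; set Y2 := [fset p in _ | _].
  have h1 : edge_weight alpha D1 Y1 <= (new_count Y1)%:R + (if based s Y1 then Num.max 0 x else 0).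
    by apply: a1; apply: fsubsetIr.
  have h2 : edge_weight alpha D2 Y2 <= (new_count Y2)%:R + (if based (s + n) Y2 then Num.max 0 x' else 0).
    by apply: a2; apply: fset_sub.
  have b1 : based s Y1 = based s Y.
    rewrite /based /Y1 fsubsetI; case: (full s 0 `<=` Y) => //=.
    by apply/fsubsetP => -[j|k]; rewrite !full_in.
  have b2 : based (s + n) Y2 -> Y1 = full s n.
    move=> /fsubsetP b; apply/eqP; rewrite eqEfsubset fsubsetIr /= fsubsetI fsubset_refl andbT.
    apply/fsubsetP => -[j|k]; rewrite full_in => h.
      by have := b (inl j); rewrite !inE !full_in ltn_addr //= h => /(_ isT).
    have := b (inl (s + k)%N); rewrite !inE !full_in ltn_add2l h /=.
    by rewrite ltnNge leq_addr /= addKn => /(_ isT).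
  have mx (y : R) : Num.max 0 y = 0 \/ Num.max 0 y = y.
    by case: (leP 0 y) => _; [right|left].
  have m1 : 0 <= Num.max 0 (x + x') by rewrite le_max lexx.
  have m2 : x + x' <= Num.max 0 (x + x') by rewrite le_max lexx orbT.
  rewrite b1 in h1; case: ifP h2 => [/b2 Y1E|_] h2.
    have bY : based s Y by rewrite -b1 Y1E based_full.
    rewrite bY Y1E w1 new_count_full.
    by case: (mx x') h2 => -> h2; case: hx => ?; lra.
  move: h1; case: ifP => // _ h1; last by lra.
  by case: (mx x) h1 => -> h1; case: hx => ?; lra.
- rewrite wD; last exact: fsubset_refl.
  have -> : full s (n + n') `&` full s n = full s n.
    apply/eqP; rewrite eqEfsubset fsubsetIr /= fsubsetI fsubset_refl andbT.
    by apply/fsubsetP => -[j|k]; rewrite !full_in // => h; rewrite ltn_addr.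
  have -> : [fset p in full (s + n) n' | rho p \in full s (n + n')] = full (s + n) n'.
    apply/fsetP => p; rewrite !inE /=; case h : (p \in _) => //=.
    exact: relabel_full.
  by rewrite w1 w2 natrD; lra.
Qed.

Lemma reach_vertex s : reach s 1 (-1).
Proof.
have [D [vD aD wD]] := reach0 s.
have [D' [vD' aD' wD']] : exists D, [/\ wf_diag ar s 1 D,
  forall Y, edge_weight alpha D Y = 0 & True].
  exists (fun _ => fset0); split=> // Y; rewrite /edge_weight big1 // => E _; rewrite /edge_count.
  have -> : [fset e in fset0 | e `<=` Y] = fset0 :> {fset {fset pos}}.
    by apply/fsetP => e; rewrite !inE.
  by rewrite cardfs0 mulr0.
exists D'; split=> // [Y _|]; rewrite aD'; last by rewrite subrr.
by rewrite max_l ?lerN10 //; case: ifP; rewrite addr0.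
Qed.

Lemma reach_edge s F : reach s (ar F) (alpha F - (ar F)%:R).
Proof.
pose e := full 0 (ar F).
have ce : #|` e| = ar F.
  rewrite -[RHS](new_count_full 0) /new_count; congr #|` _|.
  apply/fsetP => -[j|k]; rewrite !inE /= ?andbT //.
  by rewrite andbF full_in.
pose D E := if E == F then [fset e] else fset0.
have wD Y : edge_weight alpha D Y = if e `<=` Y then alpha F else 0.
  rewrite /edge_weight (bigD1 F) //= big1 ?addr0 => [|E nE]; last first.
    rewrite /edge_count /D (negbTE nE); have -> : [fset e in fset0 | e `<=` Y] = fset0 :> {fset {fset pos}}.
      by apply/fsetP => e'; rewrite !inE.
    by rewrite cardfs0 mulr0.
  rewrite /edge_count /D eqxx; case: ifP => eY.
    have -> : [fset e' in [fset e] | e' `<=` Y] = [fset e].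
      by apply/fsetP => e'; rewrite !inE /=; case: eqP => // ->; rewrite eY.
    by rewrite cardfs1 mulr1.
  have -> : [fset e' in [fset e] | e' `<=` Y] = fset0.
    by apply/fsetP => e'; rewrite !inE /=; case: eqP => // ->; rewrite eY.
  by rewrite cardfs0 mulr0.
have a1 := alpha_le1 F; have a0 := alpha_gt0 F.
have r2 : 2 <= (ar F)%:R :> R by rewrite (ler_nat _ 2).
exists D; split.
- move=> E e'; rewrite /D; case: eqP => // ->; rewrite inE => /eqP ->; split=> //.
    by apply/fsubsetP => -[j|k]; rewrite !full_in.
  by exists 0%N; rewrite full_in; apply: leq_trans (ar2 F).
- move=> Y _; rewrite wD max_l; last by lra.
  rewrite (_ : (if based s Y then 0 else 0) = 0); last by case: ifP.
  rewrite addr0; case: ifP => eY; last exact: ler0n.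
  have : (ar F)%:R <= (new_count Y)%:R :> R.
    rewrite ler_nat -{1}(new_count_full 0 (ar F)); apply: fsubset_leq_card.
    by apply/fsubsetP => p; rewrite !inE /= => /andP[/(fsubsetP eY) -> ->].
  lra.
- rewrite wD; have -> : e `<=` full s (ar F).
    by apply/fsubsetP => -[j|k]; rewrite !full_in.
  lra.
Qed.

Lemma reach_vertices s h : reach s h (- h%:R).
Proof.
elim: h => [|h IH]; first by rewrite oppr0; apply: reach0.
rewrite -addn1 natrD opprD; apply: reach_comp IH _; last exact: reach_vertex.
by right; rewrite oppr_le0.
Qed.

Lemma reach_edges s n x (l : seq L) : x <= 0 -> reach s n x ->
  exists2 n', (n <= n')%N & reach s n' (x + \sum_(F <- l) (alpha F - (ar F)%:R)).
Proof.
move=> x0 rx; elim: l => [|F l [n' nn' IH]]; first by exists n; rewrite // big_nil addr0.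
have hS (l' : seq L) : \sum_(F <- l') (alpha F - (ar F)%:R) <= 0.
  rewrite big_seq; apply: sumr_le0 => G _; have := alpha_le1 G.
  have : 2 <= (ar G)%:R :> R by rewrite (ler_nat _ 2).
  lra.
exists (n' + ar F)%N; first exact: leq_trans (leq_addr _ _).
rewrite big_cons [X in x + X]addrC addrA; apply: reach_comp IH _; last exact: reach_edge.
by right; have := hS l; lra.
Qed.

Lemma reach_paths (s s0 n k : nat) (x g : R) : 0 <= g ->
    (forall s', (s0 <= s')%N -> exists n' D, minext ar alpha s' n' D g) ->
    (s0 <= n)%N -> reach s n x -> exists n', reach s n' (x + k%:R * g).
Proof.
move=> g0 hg sn rx.
suff [n' _ h] : exists2 n', (s0 <= n')%N & reach s n' (x + k%:R * g) by exists n'.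
elim: k => [|k [n' sn' IH]]; first by exists n; rewrite ?mul0r ?addr0.
have [|m [D hD]] := hg (s + n')%N; first exact: leq_trans (leq_addl _ _).
exists (n' + m)%N; first exact: leq_trans (leq_addr _ _).
rewrite -natr1 mulrDl mul1r addrA; apply: reach_comp IH _; first by left.
exact: minext_reach hD.
Qed.

Hypothesis hnot : ~ (forall E, ar E = 2%N /\ alpha E = 1).

(** All paths use one symbol [E0] and have drop 1/q(E0). The total drop they must supply is first
    made an integer by steps that raise the rank; an integer is a multiple of 1/q(E0). *)
Lemma reach_rational (p q : L -> nat) (s : nat) (w : nat) (N : L -> nat) :
    (forall E, (0 < p E <= q E)%N /\ coprime (q E) (p E)) ->
    (forall E, alpha E = (p E)%:R / (q E)%:R) ->
    0 <= w%:R - \sum_E alpha E * (N E)%:R ->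
  exists n, reach s n (w%:R - \sum_E alpha E * (N E)%:R).
Proof.
move=> hpq aE; set x := w%:R - _ => x0.
have qR E : (q E)%:R != 0 :> R.
  by have [/andP[p0 pq] _] := hpq E; rewrite pnatr_eq0 -lt0n (leq_trans p0).
have [E0 nE0] : exists E, ~ (ar E = 2%N /\ alpha E = 1) by apply/existsNP.
have [hp0 cop] := hpq E0.
have hr : (3 <= ar E0)%N \/ (p E0 < q E0)%N.
  have := ar2 E0; rewrite leq_eqVlt => /predU1P[r2|]; last by left.
  right; rewrite ltn_neqAle; have /andP[_ ->] := hp0; rewrite andbT.
  by apply/eqP => pq; apply: nE0; rewrite -r2 aE pq divff.
(* That many free points make the base large enough for [rational_minext], however small [s] is. *)
set h := ((q E0).+2 + ar E0)%N.
(* With the [N E] edges already counted this makes q(E) N(E) edges, of integral weight p(E) N(E). *)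
pose t E := ((q E).-1 * N E)%N.
pose l := flatten [seq nseq (t E) E | E <- enum L].
have sl : \sum_(F <- l) (alpha F - (ar F)%:R) = \sum_E (t E)%:R * (alpha E - (ar E)%:R).
  rewrite /l big_flatten big_map big_enum; apply: eq_bigr => E _.
  by rewrite big_nseq mulr_natl; elim: (t E) => //= m ->; rewrite mulrS.
have [|n hn rn] := @reach_edges s h (- h%:R) l _ (reach_vertices s h).
  by rewrite oppr_le0.
pose A := (w + h + \sum_E t E * ar E)%N.
pose B := (\sum_E p E * N E)%N.
have AB : A%:R - B%:R = x + h%:R - \sum_E (t E)%:R * (alpha E - (ar E)%:R).
  rewrite /A /B !natrD !natr_sum /x.
  have -> : \sum_E (p E * N E)%:R =
    \sum_E alpha E * (N E)%:R + \sum_E (t E)%:R * alpha E.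
    rewrite -big_split /=; apply: eq_bigr => E _.
    have q0 : (0 < q E)%N by have [/andP[p0 pq] _] := hpq E; apply: leq_trans pq.
    rewrite [t E]/(_ * _)%N natrM [(_.-1 * _)%:R]natrM.
    have -> : (q E).-1%:R = (q E)%:R - 1 :> R by rewrite -[in RHS](prednK q0) -natr1 addrK.
    by rewrite aE; field.
  have -> : \sum_E (t E * ar E)%:R = \sum_E (t E)%:R * alpha E -
      \sum_E (t E)%:R * (alpha E - (ar E)%:R).
    by rewrite -sumrB; apply: eq_bigr => E _; rewrite natrM; ring.
  ring.
have BA : (B <= A)%N.
  rewrite -(ler_nat R) -subr_ge0 AB -sl.
  have : \sum_(F <- l) (alpha F - (ar F)%:R) <= 0.
    rewrite big_seq; apply: sumr_le0 => G _; have := alpha_le1 G.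
    have : 2 <= (ar G)%:R :> R by rewrite (ler_nat _ 2).
    lra.
  have : 0 <= h%:R :> R by [].
  lra.
have [||n' rn'] := @reach_paths s h n (q E0 * (A - B)) _ (q E0)%:R^-1 _ _ hn rn.
- by rewrite invr_ge0.
- exact: rational_minext hr.
exists n'; suff <- : - h%:R + \sum_(F <- l) (alpha F - (ar F)%:R) +
  (q E0 * (A - B))%:R * (q E0)%:R^-1 = x by [].
rewrite natrM natrB // AB sl mulrAC mulfV // mul1r; ring.
Qed.

End Reach.

(** * Lowering the rank inside a saturated gluing *)

Section ZeroSets.
Variables (L : finType) (ar : L -> nat) (R : realType) (alpha : L -> R).
Hypothesis alpha_ge0 : forall E, 0 <= alpha E.
Variable M : struc L.
Notation U := (univ L (car M)).
Notation tk := (task L (car M)).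
Notation glue_delta := (@glue_delta L ar R alpha M).

Lemma glue_delta_dom (J : tk -> Prop) (Z : {fset U}) : grounded ar J ->
  glue_delta J [fset z in Z | dom J z] <= glue_delta J Z.
Proof.
move=> gJ; pose P : pred U := fun z => ~~ dom J z.
rewrite [X in _ <= X](@glue_delta_isolated _ ar _ alpha _ J P) ?gJ.1 //; last first.
- by move=> E S x eS xS; rewrite /P negbK; apply: edge_dom gJ eS xS.
- exact: gJ.1.
have -> : [fset z in Z | ~~ P z] = [fset z in Z | dom J z].
  by apply/fsetP => z; rewrite !inE /= /P negbK.
by rewrite lerDl ler0n.
Qed.

Lemma glue_delta_add_points (J : tk -> Prop) (W Z : {fset U}) (n : nat) : W `<=` Z ->
  (#|` Z| <= #|` W| + n)%N -> glue_delta J Z <= glue_delta J W + n%:R.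
Proof.
move=> WZ cZ; rewrite /glue_delta /delta.
have h1 : (#|` Z|%:R : R) <= #|` W|%:R + n%:R by rewrite -natrD ler_nat.
have h2 : \sum_E alpha E * (NE (M := glue ar J) ar E W)%:R <=
          \sum_E alpha E * (NE (M := glue ar J) ar E Z)%:R.
  apply: ler_sum => E _; rewrite ler_wpM2l // ler_nat.
  apply: fsubset_leq_card; apply/fsubsetP => S; rewrite !inE /= !fpowersetE.
  by case/andP => /fsubset_trans/(_ WZ) -> ->.
lra.
Qed.

Lemma Base_embedding (J : tk -> Prop) : all_valid ar J ->
    (forall X : {fset car M}, in_KL ar X) ->
  embedding (M := M) (N := glue ar J) (@Base L (car M)).
Proof.
move=> oJ HM; split=> [|E s]; first exact: Base_inj.
rewrite (@rel_holds_on _ ar _ (fs s)) //=; last by move=> x; rewrite in_fs.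
rewrite (map_inj_uniq (@Base_inj _ M)); congr andb.
have -> : fs (map (@Base L (car M)) s) = (@Base L (car M)) @` fs s.
  apply/fsetP => x; rewrite in_fs.
  by apply/mapP/imfsetP => -[y /= ys ->]; exists y => //=; rewrite ?in_fs // -in_fs.
apply/idP/asboolP => [h|[[S0 h /(imfset_inj (@Base_inj _ M)) ->//]|]].
  by left; exists (fs s).
case=> i Ji [e eD SE]; have [_ _ [k ke]] := (oJ _ Ji).2 _ _ eD.
have : new_point i k \in pval i @` e by apply: (in_imfset _ (pval i) ke).
by rewrite -SE => /imfsetP[].
Qed.

Lemma lift_domain (J : tk -> Prop) (B : {fset U}) : {in B, forall u, dom J u} ->
  exists X : {fset car (domain ar J)}, val @` X = B.
Proof.
move=> dB; exists (fs (pmap insub (enum_fset B))); apply/fsetP => z.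
apply/imfsetP/idP => [[x /=]|zB]; rewrite ?in_fs ?mem_pmap.
  by case/mapP => y yB; case: insubP => // u _ uy [->] ->; rewrite uy.
exists (exist (dom J) z (dB _ zB)) => //; rewrite in_fs mem_pmap.
by apply/mapP; exists z; rewrite // (insubT (dom J) (dB _ zB)).
Qed.

Lemma fresh_copy (W : {fset U}) : exists c : nat,
  forall n D a k, new_point (@Task L (car M) c n D a) k \notin W.
Proof.
pose cp (u : U) := if u is New c _ _ _ _ then c else 0%N.
exists (\max_(u <- enum_fset W) cp u).+1 => n D a k; apply/negP => uW.
have := @leq_bigmax_seq _ (enum_fset W) xpredT cp _ uW isT.
by rewrite /= ltnn.
Qed.

(** The piece is glued over [A], but a copy with no new point in [W] is used, so its full drop also
    applies to [W]. Taking [W] of least rank over [A] will then lead to rank 0. *)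
Lemma drop_extension (J : tk -> Prop) (A W : {fset U}) x n D :
    grounded ar J -> hereditary ar alpha J -> saturated ar alpha J ->
    {in A, forall u, dom J u} -> wf_diag ar #|` A| n D ->
    admissible alpha #|` A| n D x ->
    (forall Z : {fset U}, A `<=` Z -> x <= glue_delta J Z) -> A `<=` W ->
  exists2 Z : {fset U}, W `<=` Z &
    glue_delta J Z <= glue_delta J W + n%:R - edge_weight alpha D (full #|` A| n).
Proof.
move=> gJ hJ sJ dA vD aD hx AW; have [c fc] := fresh_copy W.
pose i : tk := Task c n D (enum_fset A).
have vi : valid ar i by split; [apply: fset_uniq|].
have Ji : J i.
  apply: (sJ _ _ vi _ aD) => [u uA|Z AZ]; first exact: dA.
  by apply: hx; apply/fsubsetP => u /AZ.
(* The task is removed so that [glue_delta_add_one] computes its effect; the rank of [W], which has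
   no point of this copy, is unchanged. *)
pose J' j := J j /\ j <> i.
have oJ' : all_valid ar J' by move=> j [/gJ.1].
have JE : J = add_one J' i.
  apply/funext => j; apply/propext; split=> [Jj|[[]|->]] //.
  by have [->|ji] := pselect (j = i); [right|left].
have nJ'i : ~ J' i by case.
pose V : {fset U} := (new_point i) @` fs (iota 0 n).
exists (W `|` V); first exact: fsubsetUl.
rewrite {1}JE glue_delta_add_one //.
have -> : pre i (W `|` V) = full #|` A| n.
  apply/fsetP => p; rewrite in_pre; case pf : (p \in full _ _) => //=.
  case: p pf => [j|k]; rewrite full_in => h; rewrite inE /=.
    by rewrite (fsubsetP AW) // mem_nth.
  by apply/orP; right; apply/imfsetP; exists k; rewrite ?in_fs ?mem_iota.
have -> : glue_delta J W = glue_delta J' W.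
  apply: eq_glue_delta => //; first exact: gJ.1.
  move=> j [k kW]; split=> [Jj|[] //]; split=> // ji.
  by move: kW; rewrite ji; apply/negP/fc.
rewrite lerD2r; apply: glue_delta_add_points; first exact: fsubsetUl.
rewrite cardfsU (leq_trans (leq_subr _ _)) // leq_add2l.
apply: leq_trans (leq_imfset_card _ _ _) _.
by rewrite /fs card_fseq undup_id ?iota_uniq // size_iota.
Qed.

End ZeroSets.

(** * Atomic extensions for rational weights *)

Section Rational.
Variables (L : finType) (ar : L -> nat) (R : realType) (alpha : L -> R).
Hypothesis har : forall E, (2 <= ar E)%N.
Hypothesis hal : forall E, 0 < alpha E <= 1.
Hypothesis hnot : ~ (forall E, ar E = 2%N /\ alpha E = 1).

Lemma rational_fraction (E : L) : (exists q : rat, alpha E = ratr q) ->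
  exists pq : nat * nat, [/\ (0 < pq.1 <= pq.2)%N, coprime pq.2 pq.1 &
    alpha E = pq.1%:R / pq.2%:R].
Proof.
case=> q aq; have /andP[a0 a1] := hal E.
have q0 : 0 < numq q by rewrite numq_gt0 -(ltr0q R) -aq.
have aE : alpha E = `|numq q|%N%:R / `|denq q|%N%:R.
  rewrite aq /ratr !natr_absz gtr0_norm // gtr0_norm ?denq_gt0 //.
exists (`|numq q|%N, `|denq q|%N); split=> //=; last first.
  by rewrite coprime_sym coprime_num_den.
rewrite absz_gt0 gt_eqF //=; move: a1; rewrite aE ler_pdivrMr ?mul1r ?ler_nat //.
by rewrite ltr0n absz_gt0 denq_neq0.
Qed.

Theorem rational_atomic : rational_alpha alpha ->
  forall M : struc L, model_S ar alpha M ->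
    exists N : struc L, model_S ar alpha N /\ atomic N /\
      exists f : car M -> car N, embedding f.
Proof.
move=> rat M HM.
have [pq hpq] := choice (fun E => rational_fraction (rat E)).
have alpha_gt0 E : 0 < alpha E by have /andP[] := hal E.
have alpha_le1 E : alpha E <= 1 by have /andP[] := hal E.
have alpha_ge0 E : 0 <= alpha E by apply: ltW.
have KLM X := (HM.1 X).1.
pose p E := (pq E).1; pose q E := (pq E).2.
pose J0 : task L (car M) -> Prop := fun=> False.
have gJ0 : grounded ar J0 by split.
have hJ0 : hereditary ar alpha J0.
  move=> Z; pose P : pred (univ L (car M)) := fun z => if z is New _ _ _ _ _ then true else false.
  rewrite (@glue_delta_isolated _ ar _ alpha _ J0 P) //; last first.
    by move=> E S x [[S0 _ ->]|[i []]] => /imfsetP[y _ ->].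
  apply: (@addr_ge0 R); last exact: ler0n.
  have [X XE] : exists X : {fset car M},
      [fset z in Z | ~~ P z] = (@Base L (car M)) @` X.
    exists (fs (pmap (fun z => if z is Base x then Some x else None) (enum_fset Z))).
    apply/fsetP => z; apply/idP/imfsetP.
      rewrite !inE /=; case: z => [x|????? ] /andP[zZ] // _; exists x => //=.
      by rewrite in_fs mem_pmap; apply/mapP; exists (Base L x).
    case=> x /=; rewrite in_fs mem_pmap => /mapP[[y|?????] //= yZ [->] ->].
    by rewrite !inE /= andbT.
  rewrite XE /glue_delta (@delta_embedding _ ar _ alpha M (glue ar J0) (@Base L (car M))) //.
  - exact: (HM.1 X).2 (fsubset_refl X).
  - exact: Base_embedding.
  - exact: in_KL_glue gJ0.1.
have [J [_ gJ hJ sJ]] := saturated_extension gJ0 hJ0.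
exists (domain ar J); have modN := domain_model alpha_ge0 gJ hJ sJ.
split=> //; split; last first.
  exists (fun x => exist (dom J) (Base L x) isT); split=> [x y []//|E s].
  have [_ ->] := @Base_embedding _ ar M J gJ.1 KLM.
  by rewrite /= -map_comp.
apply: (zero_atomic modN) => A.
pose A' := (val : car (domain ar J) -> univ L (car M)) @` A.
have dA : {in A', forall u, dom J u} by move=> _ /imfsetP[x _ ->]; apply: valP.
have q0 E : (0 < q E)%N by have [/andP[p0 pq'] _ _] := hpq E; apply: leq_trans pq'.
(* A common denominator: ranks are nonnegative multiples of 1/Q, so a least rank over [A'] is
   attained. *)
pose Q := (\prod_E q E)%N.
have Q0 : 0 < Q%:R :> R by rewrite ltr0n prodn_gt0.
have dlQ Z : exists k : nat, glue_delta ar alpha J Z * Q%:R = k%:R.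
  have [c cE] : exists c : L -> nat, forall E, alpha E * Q%:R = (c E)%:R.
    exists (fun E => p E * \prod_(F | F != E) q F)%N => E.
    have [_ _ ->] := hpq E; rewrite /Q (bigD1 E) //= !natrM; field.
    by rewrite pnatr_eq0 -lt0n q0.
  have : glue_delta ar alpha J Z * Q%:R =
      (#|` Z| * Q)%:R - (\sum_E c E * NE (M := glue ar J) ar E Z)%:R.
    rewrite /glue_delta /delta mulrBl natrM natr_sum mulr_suml; congr (_ - _).
    by apply: eq_bigr => E _; rewrite natrM -cE mulrAC.
  have := hJ Z; rewrite -(pmulr_lge0 _ Q0) => + e; rewrite e subr_ge0 ler_nat => h.
  by exists (#|` Z| * Q - \sum_E c E * NE (M := glue ar J) ar E Z)%N; rewrite natrB.
pose T (k : nat) := `[< exists2 Z, A' `<=` Z & glue_delta ar alpha J Z * Q%:R = k%:R >].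
have exT : exists k, T k.
  by have [k h] := dlQ A'; exists k; apply/asboolP; exists A'.
case: (ex_minnP exT) => k /asboolP[W AW Wk] kmin.
have Wmin Z : A' `<=` Z -> glue_delta ar alpha J W <= glue_delta ar alpha J Z.
  move=> AZ; rewrite -(ler_pM2r Q0) Wk; have [l lE] := dlQ Z; rewrite lE ler_nat.
  by apply: kmin; apply/asboolP; exists Z.
have [n [D [vD aD wD]]] : exists n, reach ar alpha #|` A'| n (glue_delta ar alpha J W).
  apply: (@reach_rational _ ar _ alpha alpha_gt0 alpha_le1 har hnot p q) => //.
  - by move=> E; have [] := hpq E.
  - by move=> E; have [] := hpq E.
  - exact: hJ.
rewrite max_r in aD; last exact: hJ.
have [Z WZ] := drop_extension alpha_ge0 gJ hJ sJ dA vD aD Wmin AW.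
rewrite wD => Z0; have {}Z0 : glue_delta ar alpha J Z <= 0 by lra.
(* Points of absent tasks are isolated, so discarding them does not raise the rank. *)
pose B := [fset z in Z | dom J z].
have [X XB] : exists X : {fset car (domain ar J)}, val @` X = B.
  by apply: lift_domain => u; rewrite !inE => /andP[].
exists X.
  rewrite -(imfset_fsubset _ _ (@val_inj _ _ (car (domain ar J)))) XB; apply/fsubsetP => u uA.
  by rewrite !inE /= dA // (fsubsetP WZ) // (fsubsetP AW).
apply/eqP; rewrite eq_le delta_domain // XB hJ andbT.
exact: le_trans (glue_delta_dom _ _ gJ) Z0.
Qed.

End Rational.

(** * An irrational weight *)

Section SmallDrops.
Variables (L : finType) (ar : L -> nat) (R : realType) (alpha : L -> R) (E0 : L).
Let a := alpha E0.
Hypotheses (a_gt0 : 0 < a) (a_le1 : a <= 1) (ar2 : (2 <= ar E0)%N).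
Hypothesis irr : ~ exists q : rat, a = ratr q.

Lemma irr_comb (m n : int) : a * m%:~R = n%:~R -> m = 0.
Proof.
move=> e; apply/eqP/negPn/negP => m0; apply: irr; exists (n%:~R / m%:~R).
by rewrite fmorph_div /= !ratr_int -e mulfK // intr_eq0.
Qed.

(* Euclid's algorithm on [a] and [1]; [n != 0] keeps the remainders nonzero. *)
Lemma small_comb (k : nat) : exists m n : int,
  [/\ n != 0, 0 < a * m%:~R - n%:~R, a * m%:~R - n%:~R <= a &
      (a * m%:~R - n%:~R) * (2 ^ k)%:R <= a].
Proof.
have pos x : x != 0 -> 0 <= x -> 0 < x :> R by move=> ? ?; rewrite lt_neqAle eq_sym; apply/andP.
elim: k => [|k [m [n [n0 x0 xa hx]]]].
  pose t := Num.truncn a^-1.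
  have /andP[t1 t2] : t%:R <= a^-1 < t.+1%:R by apply: truncn_itv; rewrite invr_ge0 ltW.
  have h1 : a * t%:R <= 1 by rewrite mulrC -ler_pdivlMr // mul1r.
  have h2 : 1 < a * t.+1%:R by rewrite mulrC -ltr_pdivrMr // mul1r.
  have e : t.+1%:Z%:~R = t%:R + 1 :> R by rewrite -pmulrn natr1.
  exists t.+1%:Z, 1; rewrite e mulr1z expn0 mulr1.
  by move: h2; rewrite -natr1 mulrDr mulr1 => h2; split=> //; lra.
set x := a * m%:~R - n%:~R in x0 xa hx.
pose t := Num.truncn (a / x).
have /andP[t1 t2] : t%:R <= a / x < t.+1%:R by apply: truncn_itv; rewrite divr_ge0 // ltW.
have h1 : t%:R * x <= a by rewrite -ler_pdivlMr.
have h2 : a < t.+1%:R * x by rewrite -ltr_pdivrMr.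
have t0 : (0 < t)%N.
  by rewrite lt0n; apply/eqP => t0; move: h2; rewrite t0 mul1r ltNge xa.
have tZ : t%:Z != 0 by rewrite eqz_nat -lt0n.
pose y := a - t%:R * x.
have yE : y = a * (1 - t%:Z * m)%:~R - (- (t%:Z * n))%:~R.
  by rewrite /y /x !rmorphB rmorphN !rmorphM /= -!pmulrn; ring.
have y0 : 0 < y.
  apply: pos; last by rewrite /y subr_ge0.
  apply/eqP => y0; have /irr_comb e : a * (1 - t%:Z * m)%:~R = (- (t%:Z * n))%:~R.
    by apply/eqP; rewrite -subr_eq0 -yE y0.
  move: yE; rewrite y0 e mulr0 sub0r => /esym/eqP.
  by rewrite oppr_eq0 intr_eq0 oppr_eq0 mulf_eq0 (negbTE n0) (negbTE tZ).
have yx : y < x by rewrite /y; move: h2; rewrite -natr1 mulrDl mul1r; lra.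
have h3 z : z * 2 <= x -> z * (2 ^ k.+1)%:R <= a.
  move=> zx; apply: le_trans hx; rewrite expnS natrM mulrA.
  by rewrite ler_wpM2r.
(* One of [y] and [x - y] is at most half of [x]. *)
have [hy|hy] := lerP (y * 2) x.
  exists (1 - t%:Z * m), (- (t%:Z * n)); rewrite -yE; split=> //.
  - by rewrite oppr_eq0 mulf_neq0.
  - lra.
  - exact: h3.
have zE : x - y = a * (t.+1%:Z * m - 1)%:~R - (t.+1%:Z * n)%:~R.
  by rewrite /y /x !rmorphB !rmorphM /= -!pmulrn -natr1; ring.
exists (t.+1%:Z * m - 1), (t.+1%:Z * n); rewrite -zE; split=> //.
- by rewrite mulf_neq0.
- by rewrite subr_gt0.
- lra.
- by apply: h3; lra.
Qed.

(** [small_comb] does not control the sign of [n]. If it is negative, the remainder of [a] modulo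
    the small combination is smaller still, and its [n] is positive. *)
Lemma small_excess (th : R) : 0 < th ->
  exists m n : nat, (0 < n)%N /\ 0 < a * m%:R - n%:R < th.
Proof.
move=> th0; have [k hk] : exists k, a < th * (2 ^ k)%:R.
  exists (Num.truncn (a / th)).+1.
  have /andP[_] : (Num.truncn (a / th))%:R <= a / th < (Num.truncn (a / th)).+1%:R.
    by apply: truncn_itv; rewrite divr_ge0 // ltW.
  rewrite ltr_pdivrMr // mulrC => /lt_le_trans; apply.
  by rewrite ler_wpM2l ?(ltW th0) // ler_nat ltnW // ltn_expl.
have [m [n [n0 x0 xa hx]]] := small_comb k.
have xth : a * m%:~R - n%:~R < th.
  have p0 : 0 < (2 ^ k)%:R :> R by rewrite ltr0n expn_gt0.
  by rewrite -(ltr_pM2r p0); apply: le_lt_trans hk.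
have fin (m' n' : int) : 0 < n' -> 0 < a * m'%:~R - n'%:~R < th ->
    exists m n : nat, (0 < n)%N /\ 0 < a * m%:R - n%:R < th.
  move=> n'0 /andP[h1 h2].
  have m'0 : 0 < m'.
    rewrite -(ltr0z R) -(pmulr_rgt0 _ a_gt0).
    have : 0 < n'%:~R :> R by rewrite ltr0z.
    lra.
  exists `|m'|%N, `|n'|%N; rewrite absz_gt0 gt_eqF // !natr_absz !gtr0_norm //.
  by rewrite h1 h2.
have [n'0|] := ltrP 0 n; first by apply: (fin m n) => //; rewrite x0 xth.
rewrite le_eqVlt (negbTE n0) /= => nl0.
set x := a * m%:~R - n%:~R in x0 xa hx xth.
pose t := Num.truncn (a / x).
have /andP[t1 t2] : t%:R <= a / x < t.+1%:R by apply: truncn_itv; rewrite divr_ge0 // ltW.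
have h1 : t%:R * x <= a by rewrite -ler_pdivlMr.
have h2 : a < t.+1%:R * x by rewrite -ltr_pdivrMr.
have t0 : (0 < t)%N.
  by rewrite lt0n; apply/eqP => t0; move: h2; rewrite t0 mul1r ltNge xa.
have tZ : t%:Z != 0 by rewrite eqz_nat -lt0n.
pose y := a - t%:R * x.
have yE : y = a * (1 - t%:Z * m)%:~R - (- (t%:Z * n))%:~R.
  by rewrite /y /x !rmorphB rmorphN !rmorphM /= -!pmulrn; ring.
apply: (fin (1 - t%:Z * m) (- (t%:Z * n))).
  by rewrite oppr_gt0 pmulr_rlt0.
rewrite -yE; apply/andP; split; last first.
  by rewrite /y; move: h2; rewrite -natr1 mulrDl mul1r; lra.
rewrite lt_neqAle; apply/andP; split; last by rewrite /y subr_ge0.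
apply/eqP => /esym y0; have /irr_comb e : a * (1 - t%:Z * m)%:~R = (- (t%:Z * n))%:~R.
  by apply/eqP; rewrite -subr_eq0 -yE y0.
move: yE; rewrite y0 e mulr0 sub0r => /esym/eqP.
by rewrite oppr_eq0 intr_eq0 oppr_eq0 mulf_eq0 (negbTE n0) (negbTE tZ).
Qed.

Lemma irr_lt1 : a < 1.
Proof.
rewrite lt_neqAle a_le1 andbT; apply/eqP => a1; apply: irr; exists 1.
by rewrite rmorph1.
Qed.

(** The size of the base depends on [a] and the arity only, not on the bound for the drop: it has to
    accommodate the edges of a single path point, about 1/a in number. *)
Lemma small_drops : exists2 s : nat, (0 < s)%N & forall th : R, 0 < th ->
  exists2 g, 0 < g < th & exists n D, minext ar alpha s n D g.
Proof.
have a1 := irr_lt1; have a0 : 0 < a := a_gt0.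
(* Consecutive values of [f] satisfy a (f(i+1) - f(i)) < 1 + 2a <= 3: one rounding error of at most
   a at each end. *)
pose C := (Num.truncn (3 / a)).+1; pose s := (C + ar E0)%N.
exists s; first by rewrite /s addSn.
move=> th th0.
pose fl i := Num.truncn (i%:R / a).
have flP i : (fl i)%:R * a <= i%:R < (fl i).+1%:R * a.
  rewrite -ler_pdivlMr // -ltr_pdivrMr //; apply: truncn_itv.
  by rewrite divr_ge0 // ltW.
pose ga i := a * (fl i).+1%:R - i%:R.
have ga0 i : 0 < ga i by have /andP[_] := flP i; rewrite mulrC subr_gt0.
have gaa i : ga i <= a.
  by have /andP[h _] := flP i; rewrite /ga -natr1 mulrDr mulr1 [a * _]mulrC; lra.
(* For [n >= N0] the path has at least n + s edges, as [cover] requires. The bound [th'] lies below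
   all earlier excesses, which forces this length. *)
pose N0 := (Num.truncn (s%:R / (1 - a))).+1.
have [th' [th'0 th'th hth']] : exists th', [/\ 0 < th', th' <= th &
    forall i, (i < N0)%N -> th' <= ga i].
  elim: N0 => [|N [t [t0 tth ht]]]; first by exists th.
  exists (Num.min t (ga N)); split=> [||i]; rewrite ?lt_min ?ge_min ?t0 ?ga0 ?tth //.
  by rewrite ltnS leq_eqVlt => /predU1P[->|/ht ->]; rewrite ?lexx ?orbT.
have exn : exists n, (0 < n)%N && (ga n < th').
  have [m [n [n0 /andP[h1 h2]]]] := small_excess th'0.
  exists n; rewrite n0 /=; apply: le_lt_trans h2.
  rewrite /ga lerD2r ler_wpM2l ?(ltW a0) // ler_nat ltnNge; apply/negP => mfl.
  have /andP[h _] := flP n.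
  have : a * m%:R <= n%:R.
    by apply: le_trans h; rewrite mulrC ler_wpM2r ?(ltW a0) // ler_nat.
  lra.
(* The first [n] whose excess is below [th'] has the least excess so far. As [i - a * fl i] equals
   [a - ga i], this is the hypothesis [f_le] of the path. *)
case: (ex_minnP exn) => n /andP[n0 gn] nmin.
have nN0 : (N0 <= n)%N.
  by rewrite leqNgt; apply/negP => /hth'; rewrite leNgt gn.
have gmin i : (i < n)%N -> ga n <= ga i.
  move=> ni; have [->|i0] := posnP i.
    have -> : ga 0%N = a.
      by rewrite /ga /fl mul0r truncn0 mulr1 subr0.
    exact: gaa.
  rewrite leNgt; apply/negP => gi; have := nmin i; rewrite i0 (lt_trans gi gn) => /(_ isT).
  by rewrite leqNgt ni.
exists (ga n); first by rewrite ga0 (lt_le_trans gn).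
exists n; pose f i := if (i < n)%N then fl i else (fl n).+1.
have f_lo i : (i <= n)%N -> i%:R < (f i).+1%:R * a.
  rewrite leq_eqVlt /f => /predU1P[->|->]; last by have /andP[] := flP i.
  rewrite ltnn; have /andP[_ h] := flP n; apply: lt_trans h _.
  by rewrite ltr_pM2r // ltr_nat.
have f_hi i : (i <= n)%N -> (f i)%:R * a <= i%:R + a.
  rewrite leq_eqVlt /f => /predU1P[->|->]; last by have /andP[h _] := flP i; lra.
  by rewrite ltnn; have := gaa n; rewrite /ga mulrC; lra.
have f_lt i : (i < n)%N -> (f i < f i.+1)%N.
  move=> ni; rewrite -ltnS -(ltr_nat R) -(ltr_pM2r a0).
  have h1 := f_lo _ ni; have : (f i)%:R * a <= i%:R.
    by rewrite /f ni; have /andP[] := flP i.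
  by move: h1; rewrite -[(f i).+1%:R]natr1 -[i.+1%:R]natr1 mulrDl mul1r; lra.
have f_last : a * (f n)%:R = n%:R + ga n.
  by rewrite /f ltnn /ga; ring.
apply: (@path_minext _ ar _ alpha E0 s n f) => //.
- exact: ltW.
- by rewrite /f n0 /fl mul0r truncn0.
- by move=> i ni; rewrite /f ni subr_ge0 mulrC; have /andP[] := flP i.
- move=> i ni; rewrite /f ni; have := gmin _ ni.
  by rewrite /ga -!natr1 mulrDr mulr1; rewrite -/a; lra.
- move=> i ni; rewrite /s leq_add2r leq_subLR /C.
  rewrite -ltnS -(ltr_nat R) -(ltr_pM2r a0).
  have h1 := f_hi _ ni; have h2 := f_lo _ (ltnW ni).
  have /andP[_] : (Num.truncn (3 / a))%:R <= 3 / a < C%:R.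
    by apply: truncn_itv; rewrite divr_ge0 // ltW.
  rewrite ltr_pdivrMr // => h3; move: h1 h2 h3.
  rewrite -!natr1 natrD; rewrite !mulrDl !mul1r; lra.
left; rewrite leq_subRL.
  rewrite -(ler_nat R) -(ler_pM2r a0) natrD.
  have /andP[_] : (Num.truncn (s%:R / (1 - a)))%:R <= s%:R / (1 - a) < N0%:R.
    by apply: truncn_itv; rewrite divr_ge0 // subr_ge0 ltW.
  rewrite ltr_pdivrMr ?subr_gt0 // => h3.
  have h4 : N0%:R * (1 - a) <= n%:R * (1 - a).
    by rewrite ler_wpM2r ?subr_ge0 ?(ltW a1) // ler_nat.
  have h5 : s%:R * a <= s%:R by rewrite ler_piMr // ltW.
  have := f_last; have := ga0 n; move: h3 h4 h5; rewrite mulrC; lra.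
rewrite -(ler_nat R) -(ler_pM2r a0) mulrC.
have h5 : a * n%:R <= n%:R by rewrite ler_piMl // ltW.
have := f_last; have := ga0 n; rewrite [_ * a]mulrC; lra.
Qed.

End SmallDrops.

(** * Coding branches by series of drops *)

Section Ladder.
Variables (R : realType) (s : R) (good : R -> Prop).
Hypothesis s_gt0 : 0 < s.
Hypothesis good_small : forall th, 0 < th -> exists2 g, 0 < g < th & good g.

(* A branch [eta] of the binary tree is turned into a strictly decreasing
   sequence of good numbers [rho eta k], with multiplicities [mult eta k], that
   adds up to [s] and has range determining [eta]. *)
Lemma ladder : exists (rho : (nat -> bool) -> nat -> R) (mult : (nat -> bool) -> nat -> nat),
  [/\ forall eta k, 0 < rho eta k /\ good (rho eta k),
      forall eta k, (0 < mult eta k)%N,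
      forall eta K, 0 < s - \sum_(0 <= k < K) (mult eta k)%:R * rho eta k,
      forall eta e, 0 < e ->
        exists K, s - \sum_(0 <= k < K) (mult eta k)%:R * rho eta k < e
    & forall eta nu, (forall k, exists l, rho eta k = rho nu l) ->
        (forall k, exists l, rho nu k = rho eta l) -> eta = nu].
Proof.
have [pk hpk] : exists pk : R -> R, forall th, 0 < th -> 0 < pk th < th /\ good (pk th).
  suff /choice[pk hpk] : forall th : R, exists g, 0 < th -> 0 < g < th /\ good g by exists pk.
  move=> th; have [/good_small[g ? ?]|h] := ltrP 0 th; first by exists g.
  by exists 0.
(* The greatest multiplicity that leaves a positive remainder; the remainder is then at most the
   step itself. *)
have [jn hjn] : exists jn : R * R -> nat, forall p, 0 < p.2 < p.1 ->
    [/\ (0 < jn p)%N, (jn p)%:R * p.2 < p.1 & p.1 <= (jn p).+1%:R * p.2].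
  suff /choice[jn h] : forall p : R * R, exists j, 0 < p.2 < p.1 ->
    [/\ (0 < j)%N, j%:R * p.2 < p.1 & p.1 <= j.+1%:R * p.2] by exists jn.
  move=> [x r] /=; have [/andP[r0 rx]|h] := boolP (0 < r < x); last by exists 0%N.
  pose t := Num.truncn (x / r).
  have /andP[t1 t2] : t%:R <= x / r < t.+1%:R.
    by apply: truncn_itv; rewrite divr_ge0 ?ltW // (lt_trans r0).
  rewrite ler_pdivlMr // in t1; rewrite ltr_pdivrMr // in t2.
  move: t1; rewrite le_eqVlt => /predU1P[e|h]; last first.
    exists t => _; split; [|by []|exact: ltW].
    by rewrite lt0n; apply/eqP => t0; move: t2; rewrite t0 mul1r ltNge (ltW rx).
  case: t e t2 => [|[|t]] e t2.
  - by move: rx; rewrite -e mul0r ltNge (ltW r0).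
  - by move: rx; rewrite -e mul1r ltxx.
  - exists t.+1 => _; split=> //; last by rewrite e.
    by rewrite -e ltr_pM2r // ltr_nat.
(* Staying below the remainder [x] makes the steps decrease; the bound 1/(k+1) makes the remainders
   tend to 0. *)
pose mn (x : R) (k : nat) : R := Num.min x k.+1%:R^-1.
pose rr (b : bool) x k : R := if b then pk (mn x k) else pk (pk (mn x k)).
have mn0 x k : 0 < x -> 0 < mn x k by move=> x0; rewrite lt_min x0 invr_gt0 ltr0n.
have rrP b x k : 0 < x -> [/\ 0 < rr b x k, rr b x k < mn x k & good (rr b x k)].
  move=> x0; have [/andP[h1 h2] h3] := hpk _ (mn0 _ k x0); case: b => /=; first by split.
  have [/andP[h1' h2'] h3'] := hpk _ h1; split=> //; exact: lt_trans h2.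
have rrx b x k : 0 < x -> 0 < rr b x k < x.
  move=> x0; have [-> h _] := rrP b _ k x0; rewrite (lt_le_trans h) //.
  by rewrite ge_min lexx.
pose st eta := fix st (k : nat) : R := if k is k'.+1 then
  let r := rr (eta k') (st k') k' in st k' - (jn (st k', r))%:R * r else s.
have st0 eta k : 0 < st eta k.
  elim: k => [//|k IH] /=; rewrite subr_gt0.
  by have [] := hjn (st eta k, rr (eta k) (st eta k) k) (rrx _ _ _ IH).
pose rho eta k := rr (eta k) (st eta k) k.
pose mult eta k := jn (st eta k, rho eta k).
have multP eta k := hjn (st eta k, rho eta k) (rrx _ _ _ (st0 eta k)).
have stE eta K : s - \sum_(0 <= k < K) (mult eta k)%:R * rho eta k = st eta K.
  elim: K => [|K IH]; first by rewrite big_geq // subr0.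
  by rewrite big_nat_recr //= opprD addrA IH.
have st_rho eta k : st eta k.+1 <= rho eta k.
  have [_ _] := multP eta k; rewrite /= -natr1 mulrDl mul1r.
  rewrite -/(rho eta k) -/(mult eta k); lra.
have rho_dec eta k l : (k < l)%N -> rho eta l < rho eta k.
  have step m : rho eta m.+1 < rho eta m.
    apply: lt_le_trans (st_rho eta m); have /andP[_] := rrx (eta m.+1) _ m.+1 (st0 eta m.+1).
    by [].
  elim: l => // l IH; rewrite ltnS leq_eqVlt => /predU1P[->|/IH]; first exact: step.
  exact: lt_trans.
(* At the first disagreement the branch with value [true] takes the larger step. It lies strictly
   below the common earlier steps and strictly above all remaining steps of the other branch, so it
   never occurs there. *)
have diff (eta nu : nat -> bool) (k : nat) : (forall j, (j < k)%N -> eta j = nu j) -> eta k -> ~~ nu k ->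
    (exists l, rho eta k = rho nu l) -> False.
  move=> en ek nk [l e].
  have se j : (j <= k)%N -> st eta j = st nu j.
    by elim: j => [//|j IH] jk /=; rewrite en // IH // ltnW.
  have re j : (j < k)%N -> rho eta j = rho nu j.
    by move=> jk; rewrite /rho en // se // ltnW.
  have hk : rho nu k < rho eta k.
    rewrite /rho -se // ek (negbTE nk) /=.
    have [/andP[h1 _] _] := hpk _ (mn0 _ k (st0 eta k)).
    by have [/andP[]] := hpk _ h1.
  have [lk|kl|lk] := ltngtP l k.
  - by have := rho_dec eta _ _ lk; rewrite (re _ lk) e ltxx.
  - by have := lt_trans (rho_dec nu _ _ kl) hk; rewrite e ltxx.
  - by move: hk; rewrite e lk ltxx.
exists rho, mult; split.
- by move=> eta k; have [? _ ?] := rrP (eta k) _ k (st0 eta k).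
- by move=> eta k; have [] := multP eta k.
- by move=> eta K; rewrite stE.
- move=> eta e e0; pose k := Num.truncn e^-1; exists k.+1; rewrite stE.
  apply: le_lt_trans (st_rho eta k) _.
  have [_ h _] := rrP (eta k) _ k (st0 eta k); apply: lt_le_trans h _.
  rewrite ge_min; apply/orP; right.
  have /andP[_ h] : k%:R <= e^-1 < k.+1%:R by apply: truncn_itv; rewrite invr_ge0 ltW.
  by rewrite -[leRHS]invrK lef_pV2 ?posrE ?invr_gt0 ?ltr0n // ltW.
move=> eta nu h1 h2; apply: contrapT => ne.
have exk : exists k, eta k != nu k.
  by apply: contrapT => /forallNP h; apply: ne; apply/funext => k; apply/eqP/negP => /negP/h.
case: (ex_minnP exk) => k nk kmin.
have en j : (j < k)%N -> eta j = nu j.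
  by move=> jk; apply/eqP/negPn/negP => /kmin; rewrite leqNgt jk.
case ek : (eta k) nk => nk.
  by apply: (diff eta nu k) => //; rewrite ?ek //; case: (nu k) nk.
apply: (diff nu eta k) => [j jk||| //]; first by rewrite en.
  by case: (nu k) nk.
by rewrite ek.
Qed.

End Ladder.

Lemma sum_fibres (T : choiceType) (K : eqType) (key : T -> K) (r : seq K) (Z : {fset T}) :
  uniq r -> (\sum_(i <- r) #|` [fset z in Z | key z == i]| <= #|` Z|)%N.
Proof.
elim: r Z => [|i r IH] Z /=; first by rewrite big_nil.
case/andP=> ir ur; rewrite big_cons.
pose Z' := [fset z in Z | key z != i].
have -> : #|` Z| = (#|` [fset z in Z | key z == i]| + #|` Z'|)%N.
  rewrite -cardfsUI; have -> : [fset z in Z | key z == i] `&` Z' = fset0.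
    by apply/fsetP => z; rewrite !inE /=; case: (key z == i); rewrite ?andbF.
  rewrite cardfs0 addn0; congr #|` _|; apply/fsetP => z; rewrite !inE /=.
  by case: (key z == i); rewrite ?andbF ?andbT ?orbF.
rewrite leq_add2l; apply: leq_trans (IH Z' ur); rewrite big_seq [leqRHS]big_seq.
apply: leq_sum => j jr; apply: fsubset_leq_card; apply/fsubsetP => z.
rewrite !inE /= => /andP[-> /eqP kz]; rewrite kz eqxx andbT /=.
by apply: contraNneq ir => <-.
Qed.

(** * Fans *)

Section Fans.
Variables (L : finType) (ar : L -> nat) (R : realType) (alpha : L -> R).
Hypothesis alpha_ge0 : forall E, 0 <= alpha E.
Variables (s : nat) (rho : (nat -> bool) -> nat -> R) (mult : (nat -> bool) -> nat -> nat).
Variables (nn : R -> nat) (DD : R -> L -> {fset {fset pos}}).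
Hypothesis s_gt0 : (0 < s)%N.
Hypothesis rho_gt0 : forall eta k, 0 < rho eta k.
Hypothesis rho_ext : forall eta k,
  minext ar alpha s (nn (rho eta k)) (DD (rho eta k)) (rho eta k).
Hypothesis mult_gt0 : forall eta k, (0 < mult eta k)%N.
Hypothesis rho_sum : forall eta K,
  0 < s%:R - \sum_(0 <= k < K) (mult eta k)%:R * rho eta k.
Hypothesis rho_lim : forall eta e, 0 < e ->
  exists K, s%:R - \sum_(0 <= k < K) (mult eta k)%:R * rho eta k < e.

(** The starting structure has no relations; each [eta] will use its own [s] points, so every base
    has rank [s]. *)
Definition points : struc L :=
  @Struc L ((nat -> bool) * nat)%type (fun _ _ => false).
Notation U := (univ L (car points)).
Notation tk := (task L (car points)).

Definition base_points (eta : nat -> bool) : seq U := [seq Base L (eta, j) : U | j <- iota 0 s].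
Definition fan_task (eta : nat -> bool) (k j : nat) : tk :=
  Task (choice.pickle (k, j)) (nn (rho eta k)) (DD (rho eta k)) (base_points eta).
Definition fan (i : tk) := exists eta k j, (j < mult eta k)%N /\ i = fan_task eta k j.
Definition fan_seq (etas : seq (nat -> bool)) (K : nat) : seq tk :=
  [seq fan_task eta kj.1 kj.2 | eta <- etas,
     kj <- [seq (k, j) | k <- iota 0 K, j <- iota 0 (mult eta k)]].

Lemma size_base_points eta : size (base_points eta) = s.
Proof. by rewrite size_map size_iota. Qed.

Lemma base_points_uniq eta : uniq (base_points eta).
Proof. by rewrite map_inj_uniq ?iota_uniq // => ? ? []. Qed.

Lemma card_base_points eta : #|` fs (base_points eta)| = s.
Proof. by rewrite /fs card_fseq undup_id ?size_base_points // base_points_uniq. Qed.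

Lemma fan_task_valid eta k j : valid ar (fan_task eta k j).
Proof. by split; [exact: base_points_uniq|rewrite /= size_base_points; have [] := rho_ext eta k]. Qed.

Lemma base_points_inj eta nu : base_points eta = base_points nu -> eta = nu.
Proof. by rewrite /base_points; case: (s) s_gt0 => // n _ []. Qed.

Lemma fan_task_inj eta k j nu l j' :
  fan_task eta k j = fan_task nu l j' -> [/\ eta = nu, k = l & j = j'].
Proof.
case=> e _ _ /base_points_inj ->; have := congr1 (@choice.unpickle (nat * nat)%type) e.
by rewrite !choice.pickleK => -[-> ->].
Qed.

Lemma fan_all_valid : all_valid ar fan.
Proof. by move=> i [eta [k [j [_ ->]]]]; apply: fan_task_valid. Qed.

Lemma mem_fan_seq etas K eta k j : eta \in etas -> (k < K)%N -> (j < mult eta k)%N ->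
  fan_task eta k j \in fan_seq etas K.
Proof.
move=> he hk hj; apply/allpairsPdep; exists eta, (k, j); split=> //.
by apply/allpairsPdep; exists k, j; rewrite !mem_iota.
Qed.

Lemma fan_seqP etas K i : i \in fan_seq etas K -> exists eta k j,
  [/\ eta \in etas, (k < K)%N, (j < mult eta k)%N & i = fan_task eta k j].
Proof.
case/allpairsPdep=> eta [[k j] [he /allpairsPdep[k' [j' []]]]].
by rewrite !mem_iota /= !add0n => hk hj [-> ->] ->; exists eta, k', j'.
Qed.

Lemma fan_seq_uniq etas K : uniq etas -> uniq (fan_seq etas K).
Proof.
move=> ue; apply: allpairs_uniq_dep => // [eta _|].
  apply: allpairs_uniq_dep => [|k _|]; [exact: iota_uniq|exact: iota_uniq|].
  by move=> [? ?] [? ?] _ _ /= [-> ->].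
by move=> [eta [k j]] [nu [l j']] _ _ /= /fan_task_inj[-> -> ->].
Qed.

(** Different bases and the new points of different tasks are disjoint; [key] sorts the points
    accordingly. *)
Lemma card_lower (etas : seq (nat -> bool)) (F : seq tk) (Z : {fset U}) :
    uniq etas -> uniq F -> (forall i, i \in F -> valid ar i) ->
  (\sum_(eta <- etas) (if fs (base_points eta) `<=` Z then s else 0) +
   \sum_(i <- F) new_count (pre i Z) <= #|` Z|)%N.
Proof.
move=> ue uF vF.
pose key (u : U) : (nat -> bool) + tk :=
  match u with Base p => inl p.1 | New a b c d _ => inr (Task a b c d) end.
have ur : uniq (map inl etas ++ map inr F : seq ((nat -> bool) + tk)).
  rewrite cat_uniq !map_inj_uniq ?ue ?uF //=; try by move=> ? ? [].
  by rewrite andbT; apply/hasPn => _ /mapP[i _ ->]; apply/negP => /mapP[].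
apply: leq_trans (sum_fibres key Z ur); rewrite big_cat !big_map.
apply: leq_add; last first.
  rewrite big_seq [leqRHS]big_seq; apply: leq_sum => i /vF vi.
  apply: leq_trans (new_count_pre _ vi) _; apply: fsubset_leq_card.
  apply/fsubsetP => z; rewrite !inE /= => /andP[-> /asboolP[k ->]] /=.
  by case: i {vi} => a b c d /=.
apply: leq_sum => eta _; case: ifP => // xZ; rewrite -{1}(card_base_points eta).
apply: fsubset_leq_card; apply/fsubsetP => z zx; have := zx; rewrite in_fs.
case/mapP => j _ zE; rewrite !inE /= (fsubsetP xZ _ zx) /=.
by rewrite zE.
Qed.

Lemma glue_delta_points (Z : {fset U}) : glue_delta ar alpha (fun _ : tk => False) Z = #|` Z|%:R.
Proof.
have oF : all_valid ar (fun _ : tk => False) by [].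
rewrite /glue_delta /delta big1 ?subr0 // => E _; rewrite /NE.
set A := [fset S in _ | _]; suff -> : A = fset0 by rewrite cardfs0 mulr0.
apply/fsetP => S; rewrite in_fset0; apply/negP; rewrite !inE /= holds_on_glue //.
case/andP=> _ /asboolP[[S0 /andP[_]] //|[i []]].
Qed.

Lemma glue_delta_seq (F : seq tk) (Z : {fset U}) :
    uniq F -> (forall i, i \in F -> valid ar i) ->
  glue_delta ar alpha (fun i => i \in F) Z =
  #|` Z|%:R - \sum_(i <- F) edge_weight alpha (tdiag i) (pre i Z).
Proof.
elim: F => [|i F IH] /=.
  move=> _ _; rewrite big_nil subr0 -glue_delta_points; congr (glue_delta _ _ _ _).
  by apply/funext => i; apply/propext.
case/andP=> iF uF vF; have vF' j : j \in F -> valid ar j.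
  by move=> jF; apply: vF; rewrite inE jF orbT.
have -> : (fun j => j \in i :: F : Prop) = add_one (fun j => j \in F) i.
  apply/funext => j; apply/propext; rewrite inE.
  by split=> [/predU1P[->|]|[->|->]]; [right|left|rewrite orbT|rewrite eqxx].
rewrite glue_delta_add_one //; [|by apply: vF; rewrite mem_head|exact/negP].
by rewrite IH // big_cons; ring.
Qed.

Lemma fan_edge_weight eta k j (Z : {fset U}) (i := fan_task eta k j) :
  edge_weight alpha (tdiag i) (pre i Z) <= (new_count (pre i Z))%:R +
    (if fs (base_points eta) `<=` Z then rho eta k else 0).
Proof.
have [_ sD wD] := rho_ext eta k; have := pre_sub i Z; rewrite size_base_points => pf.
have [pE|pn] := eqVneq (pre i Z) (full s (nn (rho eta k))).
  rewrite pE wD new_count_full; case: ifP => // /negP[]; apply/fsubsetP => u.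
  rewrite in_fs; apply: (@based_pre _ _ i).
  by rewrite pE /= size_base_points based_full.
apply: le_trans (sD _ pf pn) _; rewrite lerDl; case: ifP => // _.
exact: ltW.
Qed.

Lemma fan_sum eta K :
  \sum_(kj <- [seq (k, j) | k <- iota 0 K, j <- iota 0 (mult eta k)]) rho eta kj.1 =
  \sum_(0 <= k < K) (mult eta k)%:R * rho eta k.
Proof.
rewrite big_allpairs_dep /index_iota subn0; apply: eq_bigr => k _ /=.
by rewrite big_const_seq count_predT size_iota iter_addr_0 mulr_natl.
Qed.

(** A finite set meets finitely many branches and levels. A piece drops only over its whole base,
    whose [s] points exceed every partial sum of the drops. *)
Lemma fan_hereditary : hereditary ar alpha fan.
Proof.
move=> Z.
(* The branch of a fan point is read off the first argument, which exists as [s > 0], and its level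
   off the copy number. *)
pose eta_of (u : U) : nat -> bool :=
  match u with Base p => p.1 | New _ _ _ (Base p :: _) _ => p.1 | _ => fun=> false end.
pose k_of (u : U) : nat :=
  if u is New c _ _ _ _ then (odflt (0, 0)%N (choice.unpickle c : option (nat * nat))).1 else 0%N.
pose etas := undup [seq eta_of z | z <- enum_fset Z].
have [K hK] : exists K, forall z, z \in Z -> (k_of z < K)%N.
  exists (\max_(z <- enum_fset Z) k_of z).+1 => z zZ; rewrite ltnS.
  exact: (@leq_bigmax_seq _ (enum_fset Z) xpredT k_of _ zZ isT).
have ue : uniq etas by apply: undup_uniq.
pose F := fan_seq etas K; have uF := fan_seq_uniq K ue.
have vF i : i \in F -> valid ar i.
  by case/fan_seqP => eta [k [j [_ _ _ ->]]]; apply: fan_task_valid.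
have -> : glue_delta ar alpha fan Z = glue_delta ar alpha (fun i => i \in F) Z.
  apply: eq_glue_delta => [||i [l lZ]]; [exact: fan_all_valid|exact: vF|split].
    move=> [eta [k [j [jm iE]]]]; rewrite iE; apply: mem_fan_seq => //.
      rewrite mem_undup; apply/mapP; exists (new_point i l) => //.
      by rewrite iE /= /base_points; case: (s) s_gt0.
    by have := hK _ lZ; rewrite iE /= choice.pickleK.
  by case/fan_seqP => eta [k [j [_ _ jm ->]]]; exists eta, k, j.
rewrite glue_delta_seq // subr_ge0.
have := card_lower Z ue uF vF; rewrite -(ler_nat R) natrD !natr_sum.
apply: le_trans.
rewrite [X in X <= _]big_allpairs_dep [X in _ <= _ + X]big_allpairs_dep /= -big_split /=.
apply: ler_sum => eta _.
apply: (@le_trans _ _ (\sum_(kj <- [seq (k, j) | k <- iota 0 K, j <- iota 0 (mult eta k)])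
   ((new_count (pre (fan_task eta kj.1 kj.2) Z))%:R +
    (if fs (base_points eta) `<=` Z then rho eta kj.1 else 0)))).
  by apply: ler_sum => kj _; apply: fan_edge_weight.
rewrite big_split /= addrC lerD2r; case: ifP => _; last by rewrite big1.
by rewrite fan_sum; have := rho_sum eta K; rewrite subr_gt0 => /ltW.
Qed.

Lemma fan_grounded : grounded ar fan.
Proof.
split; first exact: fan_all_valid.
by move=> i u [eta [k [j [_ ->]]]] /mapP[l _ ->].
Qed.

Definition fan_ext (eta : nat -> bool) (k j : nat) : {fset U} :=
  fs (base_points eta ++ [seq new_point (fan_task eta k j) l | l <- iota 0 (nn (rho eta k))]).

Lemma fan_ext_pre eta k j (Z : {fset U}) :
  fs (base_points eta) `<=` Z ->
  (pre (fan_task eta k j) Z == full s (nn (rho eta k))) = (fan_ext eta k j `<=` Z).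
Proof.
set i := fan_task eta k j => /fsubsetP xZ.
apply/eqP/fsubsetP => [pE u|h].
  rewrite in_fs mem_cat => /orP[ux|/mapP[l ln ->]]; first by apply: xZ; rewrite in_fs.
  have : inr l \in pre i Z by rewrite pE full_in; move: ln; rewrite mem_iota.
  by rewrite in_pre => /andP[].
apply/eqP; rewrite eqEfsubset; apply/andP; split.
  by apply: fsubset_trans (pre_sub _ _) _; rewrite size_base_points.
apply/fsubsetP => p pf; rewrite in_pre size_base_points pf /=; apply: h; rewrite in_fs mem_cat.
case: p pf => [l|l]; rewrite full_in => ln /=.
  by rewrite mem_nth // size_base_points.
by rewrite map_f ?orbT // mem_iota.
Qed.

Lemma fan_ext_new_point eta k j i : (exists l, new_point i l \in fan_ext eta k j) -> i = fan_task eta k j.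
Proof.
by case=> l; rewrite in_fs mem_cat => /orP[/mapP[? _ //]|/mapP[l' _ /new_point_inj[]]].
Qed.

Section Uniqueness.
Variable J : tk -> Prop.
Hypotheses (fanJ : forall i, fan i -> J i) (gJ : grounded ar J) (hJ : hereditary ar alpha J).

Lemma fan_J eta k j : (j < mult eta k)%N -> J (fan_task eta k j).
Proof. by move=> jm; apply: fanJ; exists eta, k, j. Qed.

(** New points of a single task occur here, so the rest of [J] adds no edges, and minimality of the
    piece separates the whole of it from its parts. *)
Lemma glue_delta_fan_ext eta k j (S : {fset U}) : (j < mult eta k)%N ->
    fs (base_points eta) `<=` S -> S `<=` fan_ext eta k j ->
  (S = fan_ext eta k j -> glue_delta ar alpha J S = s%:R - rho eta k) /\
  (S <> fan_ext eta k j -> s%:R <= glue_delta ar alpha J S).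
Proof.
move=> jm xS SX; set i := fan_task eta k j.
have vi : valid ar i := fan_task_valid eta k j.
have -> : glue_delta ar alpha J S = #|` S|%:R - edge_weight alpha (tdiag i) (pre i S).
  have -> : glue_delta ar alpha J S = glue_delta ar alpha (fun i' => i' \in [:: i]) S.
    apply: eq_glue_delta => [||i' [l lS]]; first exact: gJ.1.
      by move=> i'; rewrite inE => /eqP ->.
    have -> : i' = i by apply: fan_ext_new_point; exists l; apply: (fsubsetP SX).
    by rewrite inE eqxx; split=> // _; apply: fan_J.
  by rewrite glue_delta_seq // ?big_seq1 // => i'; rewrite inE => /eqP ->.
have [_ sD wD] := rho_ext eta k.
split=> [SE|Sn].
  have /eqP -> : pre i S == full s (nn (rho eta k)).
    by rewrite fan_ext_pre // SE fsubset_refl.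
  rewrite wD SE /fan_ext /fs card_fseq undup_id.
    by rewrite size_cat size_base_points size_map size_iota natrD; ring.
  rewrite cat_uniq base_points_uniq map_inj_uniq ?iota_uniq ?andbT.
    by apply/hasPn => _ /mapP[l _ ->]; apply/negP => /mapP[].
  by move=> l l' /new_point_inj[].
have pn : pre i S != full s (nn (rho eta k)).
  rewrite fan_ext_pre //; apply/negP => XS; apply: Sn.
  by apply/eqP; rewrite eqEfsubset SX.
have pf : pre i S `<=` full s (nn (rho eta k)).
  by have := pre_sub i S; rewrite size_base_points.
have h1 := sD _ pf pn.
have := @card_lower [:: eta] [:: i] S isT isT; rewrite !big_seq1 xS.
rewrite -(ler_nat R) natrD => h2.
have {}h2 : s%:R + (new_count (pre i S))%:R <= #|` S|%:R :> R.
  by apply: h2 => i'; rewrite inE => /eqP ->.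
rewrite /=; lra.
Qed.

Variables (N : struc L) (e : car (domain ar J) -> car N).
Hypotheses (HN : model_S ar alpha N) (He : embedding e).

Let d0 : car (domain ar J) := exist (dom J) (Base L ((fun=> false), 0%N)) isT.
Definition place (u : U) : car N := e (odflt d0 (insub u)).

Lemma place_inj : {in dom J &, injective place}.
Proof.
move=> u v du dv; rewrite /place !insubT /= => /He.1 /(congr1 val).
by [].
Qed.

Lemma delta_place (B : {fset U}) : {in B, forall u, dom J u} ->
  delta ar alpha (place @` B) = glue_delta ar alpha J B.
Proof.
move=> dB; have [X XB] := @lift_domain _ ar _ J B dB.
have -> : place @` B = e @` X.
  rewrite -XB -imfset_comp; apply/fsetP => y.
  apply/imfsetP/imfsetP => -[x xX ->]; exists x => //=; rewrite /place valK //.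
by rewrite (delta_embedding alpha He) ?delta_domain ?XB //; apply: (HN.1 _).1.
Qed.

Lemma fan_ext_dom eta k j : (j < mult eta k)%N ->
  {in fan_ext eta k j, forall u, dom J u}.
Proof.
move=> jm u; rewrite in_fs mem_cat => /orP[/mapP[l _ ->]|/mapP[l _ ->]] //.
by rewrite dom_new_point; apply/asboolP/fan_J.
Qed.

Lemma base_points_sub_ext eta k j : fs (base_points eta) `<=` fan_ext eta k j.
Proof. by apply/fsubsetP => u; rewrite !in_fs mem_cat => ->. Qed.

(* The fan of [nu] has subsets of arbitrarily small rank, so an extension of its
   base by a minimal drop [g] has to lie in the fan. *)
Lemma fan_unique (nu : nat -> bool) (A : {fset car N}) (g : R) : 0 < g ->
    place @` fs (base_points nu) `<=` A -> delta ar alpha A = s%:R - g ->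
    (forall Y, place @` fs (base_points nu) `<=` Y -> Y `<=` A -> Y != A ->
       s%:R <= delta ar alpha Y) ->
  exists l, g = rho nu l.
Proof.
move=> g0 xA dA hA; have [K hK] := rho_lim nu g0.
pose F := fan_seq [:: nu] K; have uF : uniq F by apply: fan_seq_uniq.
have vF i : i \in F -> valid ar i.
  by case/fan_seqP => eta [k [j [_ _ _ ->]]]; apply: fan_task_valid.
have JF i : i \in F -> J i.
  by case/fan_seqP => eta [k [j [_ _ jm ->]]]; apply: fan_J.
(* The base with all its pieces below level [K]; what remains of the rank is less than [g]. *)
pose aK : {fset U} := fs (base_points nu ++ flatten [seq [seq new_point i l | l <- iota 0 (tnew i)] | i <- F]).
have aKelt i l : new_point i l \in aK -> i \in F.
  rewrite in_fs mem_cat => /orP[/mapP[? _ //]|/flatten_mapP[i' i'F /mapP[l' _]]].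
  by case/new_point_inj => ->.
have daK : {in aK, forall u, dom J u}.
  move=> u; case: u => [//|a b c d l]; rewrite -/(new_point (Task a b c d) l) => /aKelt.
  by move/JF => Ji; rewrite dom_new_point; apply/asboolP.
have dlF (S : {fset U}) : S `<=` aK -> glue_delta ar alpha J S =
    #|` S|%:R - \sum_(i <- F) edge_weight alpha (tdiag i) (pre i S).
  move=> /fsubsetP SK; rewrite -glue_delta_seq //; apply: eq_glue_delta => [||i [l /SK /aKelt iF]] //.
    exact: gJ.1.
  by split=> // _; apply: JF.
have xaK : fs (base_points nu) `<=` aK.
  by apply/fsubsetP => u; rewrite !in_fs mem_cat => ->.
have sumF : \sum_(i <- F) edge_weight alpha (tdiag i) (pre i aK) =
    (\sum_(i <- F) tnew i)%:R + \sum_(0 <= k < K) (mult nu k)%:R * rho nu k.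
  have -> : \sum_(0 <= k < K) (mult nu k)%:R * rho nu k =
      \sum_(kj <- [seq (k, j) | k <- iota 0 K, j <- iota 0 (mult nu k)]) rho nu kj.1.
    by rewrite fan_sum.
  rewrite natr_sum /F /fan_seq /= cats0 !big_map -big_split /=.
  rewrite big_seq [RHS]big_seq; apply: eq_bigr => -[k j] kj.
  have iF : fan_task nu k j \in F.
    by rewrite /F /fan_seq /= cats0; apply: (map_f (fun kj => fan_task nu kj.1 kj.2) kj).
  have [_ _ <-] := rho_ext nu k; congr edge_weight; apply/eqP.
  rewrite fan_ext_pre //; apply/fsubsetP => u.
  rewrite !in_fs !mem_cat => /orP[->//|/mapP[l ln ->]]; apply/orP; right.
  by apply/flatten_mapP; exists (fan_task nu k j) => //; apply: map_f.
have dlK : glue_delta ar alpha J aK < g.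
  rewrite dlF ?fsubset_refl // sumF; move: hK.
  have : (#|` aK| <= s + \sum_(i <- F) tnew i)%N.
    rewrite /aK /fs card_fseq (leq_trans (size_undup _)) // size_cat size_base_points leq_add2l.
    rewrite size_flatten /shape -map_comp sumnE big_map.
    by apply: leq_sum => i _; rewrite /= size_map size_iota.
  rewrite -(ler_nat R) natrD; lra.
(* Otherwise the intersection is a proper part of [A] containing the base, of rank at least s.
   Submodularity makes the rank of the union at most (s - g) + rank(aK) - s < 0. *)
have AK : A `<=` place @` aK.
  apply: contraT => nAK; pose Y := A `&` place @` aK.
  have hY : s%:R <= delta ar alpha Y.
    apply: hA; rewrite /Y ?fsubsetIl //.
    rewrite fsubsetI xA /=; apply: subset_imfset; exact: (fsubsetP xaK).
  have hge : 0 <= delta ar alpha (A `|` place @` aK).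
    exact: (HN.1 _).2 (fsubset_refl _).
  have := delta_submod ar alpha_ge0 A (place @` aK).
  rewrite delta_place // dA -/Y; lra.
clearbody aK; pose S := [fset u in aK | place u \in A].
have SK : S `<=` aK by apply: fset_sub.
have AE : A = place @` S.
  apply/fsetP => y; apply/idP/imfsetP => [yA|[u /=]].
    have /imfsetP[u /= uK yE] := fsubsetP AK _ yA.
    by exists u; rewrite // !inE /= uK -yE.
  by rewrite !inE /= => /andP[_ +] ->.
have dS : {in S, forall u, dom J u} by move=> u /(fsubsetP SK)/daK.
have xS : fs (base_points nu) `<=` S.
  apply/fsubsetP => u ux; rewrite !inE /= (fsubsetP xaK) //=.
  by apply: (fsubsetP xA); apply: in_imfset.
have dlS : glue_delta ar alpha J S = s%:R - g by rewrite -delta_place // -AE.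
(* Without a complete piece no drop would occur inside [S], whose rank would be at least s. *)
have [l [j [jm XS]]] : exists l j, (j < mult nu l)%N /\ fan_ext nu l j `<=` S.
  apply: contrapT => nX; have := dlF _ SK; rewrite dlS => h.
  have : \sum_(i <- F) edge_weight alpha (tdiag i) (pre i S) <= (\sum_(i <- F) new_count (pre i S))%:R.
    rewrite natr_sum big_seq [leRHS]big_seq; apply: ler_sum => i.
    case/fan_seqP => eta [k [j [+ _ + ->]]]; rewrite inE => /eqP -> jm.
    have [_ sD _] := rho_ext nu k; apply: sD.
      by have := pre_sub (fan_task nu k j) S; rewrite size_base_points.
    by rewrite fan_ext_pre //; apply/negP => XS; apply: nX; exists k, j.
  have := card_lower S (isT : uniq [:: nu]) uF vF; rewrite big_seq1 xS.
  rewrite -(ler_nat R) natrD; lra.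
exists l; have [dX _] := glue_delta_fan_ext jm (base_points_sub_ext nu l j) (fsubset_refl _).
have {}dX := dX erefl.
(* A complete piece already has rank below s, so by minimality of [A] it cannot be a proper part. *)
have XA : place @` fan_ext nu l j = A.
  apply/eqP; apply: contraT => /hA; rewrite AE => h.
  have : s%:R <= s%:R - rho nu l.
    rewrite -dX -delta_place; last exact: fan_ext_dom.
    by apply: h; apply: subset_imfset; apply/fsubsetP => //; apply: base_points_sub_ext.
  by have := rho_gt0 nu l; lra.
have := dA; rewrite -XA delta_place; last exact: fan_ext_dom.
rewrite dX; lra.
Qed.

Definition base_val (eta : nat -> bool) (x : nat) : car N := place (Base L (eta, x)).

(** The existential diagram of a piece over the base of [eta] is part of the type of that base. Over
    the base of [nu] it is realised by an extension with the same drop and the same minimality, to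
    which [fan_unique] applies. *)
Lemma same_type (eta nu : nat -> bool) :
    (forall psi, form_in s psi -> sat (base_val eta) psi -> sat (base_val nu) psi) ->
  forall k, exists l, rho eta k = rho nu l.
Proof.
move=> Hsat k; pose n := nn (rho eta k); pose i := fan_task eta k 0; pose m := (s + n)%N.
have j0 := mult_gt0 eta k.
pose u (x : nat) : U := if (x < s)%N then Base L (eta, x) else new_point i (x - s).
have u_inj x y : u x = u y -> x = y.
  rewrite /u; case: ltnP => hx; case: ltnP => hy //; first by case.
  by case/new_point_inj => _; lia.
have uX x : (x < m)%N -> u x \in fan_ext eta k 0.
  rewrite /u in_fs mem_cat => xm; case: ltnP => hx; first by rewrite map_f // mem_iota.
  by apply/orP; right; apply: map_f; rewrite mem_iota /= add0n ltn_subLR.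
have du x : (x < m)%N -> dom J (u x) by move=> /uX; apply: fan_ext_dom.
pose v' x := if (s <= x < m)%N then place (u x) else base_val eta x.
have v'u x : (x < m)%N -> v' x = place (u x).
  by rewrite /v' /u /base_val => ->; rewrite andbT ltnNge; case: (s <= x)%N.
pose psi := foldr (@FEx L) (qfdiag ar v' m) (iota s n).
have psis : form_in s psi.
  apply/allP => x /fv_foldr_FEx[/fv_qfdiag xm]; rewrite mem_iota -/m xm andbT.
  by rewrite -ltnNge.
have /(Hsat _ psis)/sat_foldr_FEx[w w'nu /sat_qfdiag[h1 h2]] : sat (base_val eta) psi.
  apply/sat_foldr_FEx; exists v'; last exact/sat_qfdiag.
  by move=> x; rewrite mem_iota /v' => /negbTE ->.
have wnu x : (x < s)%N -> w x = place (Base L (nu, x)).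
  by move=> xlt; rewrite w'nu // mem_iota leqNgt xlt.
pose P : struc L := @Struc L 'I_m (fun E t => rel E (map v' (map val t))).
have v'_inj x y : (x < m)%N -> (y < m)%N -> v' x = v' y -> x = y.
  by move=> xm ym; rewrite !v'u // => /place_inj -/(_ (du _ xm) (du _ ym))/u_inj.
have ev : embedding (M := P) (N := N) (fun x : 'I_m => v' (val x)).
  split=> [x y h|E t]; last by rewrite /= -map_comp.
  apply: val_inj; exact: (v'_inj _ _ (ltn_ord x) (ltn_ord y) h).
have ew : embedding (M := P) (N := N) (fun x : 'I_m => w (val x)).
  split=> [x y h|E t].
    apply: val_inj; apply: (v'_inj _ _ (ltn_ord x) (ltn_ord y)).
    exact/(h1 _ _ (ltn_ord x) (ltn_ord y)).
  rewrite /=; have -> : [seq w (val x) | x <- t] = map w (map val t) by rewrite -map_comp.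
  have [st|st] := eqVneq (size (map val t)) (ar E).
    by rewrite h2 //; apply/allP => _ /mapP[x _ ->]; apply: ltn_ord.
  have nr (f : nat -> car N) : rel E (map f (map val t)) = false.
    apply/negP => r; have HK := (HN.1 (fs (map f (map val t)))).1.
    have [|sz _ _] := HK E _ _ r; first by apply/allP => x; rewrite in_fs.
    by move: st; rewrite -sz !size_map eqxx.
  by rewrite !nr.
have KN X : in_KL ar (X : {fset car N}) := (HN.1 X).1.
pose uv (x : 'I_m) := u (val x).
have uvX (Y : {fset 'I_m}) : uv @` Y `<=` fan_ext eta k 0.
  by apply/fsubsetP => _ /imfsetP[x _ ->]; apply/uX/ltn_ord.
have dw (Y : {fset 'I_m}) : delta ar alpha ((fun x : 'I_m => w (val x)) @` Y) =
    glue_delta ar alpha J (uv @` Y).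
  rewrite (delta_embedding alpha ew) // -(delta_embedding alpha ev) //.
  have -> : (fun x : 'I_m => v' (val x)) @` Y = place @` (uv @` Y).
    rewrite -imfset_comp; apply/fsetP => y.
    by apply/imfsetP/imfsetP => -[x xY ->]; exists x => //=; rewrite v'u.
  by rewrite delta_place // => z /(fsubsetP (uvX Y)); apply: fan_ext_dom.
pose Full : {fset 'I_m} := fs (enum 'I_m).
have inF x : x \in Full by rewrite in_fs mem_enum.
have uvF : uv @` Full = fan_ext eta k 0.
  apply/eqP; rewrite eqEfsubset uvX /=; apply/fsubsetP => z; rewrite in_fs mem_cat.
  case/orP => /mapP[x]; rewrite mem_iota /= add0n => hx ->.
    have xm : (x < m)%N by rewrite ltn_addr.
    by apply/imfsetP; exists (Ordinal xm) => //; rewrite /uv /u /= hx.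
  have xm : (s + x < m)%N by rewrite ltn_add2l.
  by apply/imfsetP; exists (Ordinal xm) => //; rewrite /uv /u /= ltnNge leq_addr /= addKn.
pose wv (x : 'I_m) := w (val x).
have xsub : place @` fs (base_points nu) `<=` wv @` Full.
  apply/fsubsetP => _ /imfsetP[z /= + ->]; rewrite in_fs => /mapP[x].
  rewrite mem_iota /= add0n => hx ->; have xm : (x < m)%N by rewrite ltn_addr.
  by apply/imfsetP; exists (Ordinal xm) => //; rewrite /wv /= wnu.
apply: (@fan_unique nu (wv @` Full)) => //.
  rewrite dw uvF; have [h _] := glue_delta_fan_ext j0 (base_points_sub_ext eta k 0) (fsubset_refl _).
  exact: h.
move=> Y xY YF; have [Y0 Y0F YE] := fsubset_imfsetE YF; rewrite YE => nY.
rewrite dw; have xY0 : fs (base_points eta) `<=` uv @` Y0.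
  apply/fsubsetP => z; rewrite in_fs => /mapP[x]; rewrite mem_iota /= add0n => hx ->.
  have xm : (x < m)%N by rewrite ltn_addr.
  have : w x \in wv @` Y0.
    rewrite -YE; apply: (fsubsetP xY); rewrite wnu //; apply: in_imfset.
    by rewrite in_fs map_f // mem_iota.
  case/imfsetP => y /= yY0 wxy; apply/imfsetP; exists y => //.
  have -> : Base L (eta, x) = u x by rewrite /u hx.
  rewrite /uv; congr u; apply: (v'_inj _ _ xm (ltn_ord y)).
  exact/(h1 _ _ xm (ltn_ord y)).
have [_ h] := glue_delta_fan_ext j0 xY0 (uvX Y0); apply: h => e0.
move/eqP: nY; apply; suff -> : Y0 = Full by [].
apply/fsetP => x; rewrite inF.
have : uv x \in uv @` Y0 by rewrite e0; apply/uX/ltn_ord.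
by case/imfsetP => y /= yY0 /u_inj/val_inj ->.
Qed.

End Uniqueness.

End Fans.

(** * Countability of formulas *)

Section Countable.
Variable L : finType.

Fixpoint code_form (f : form L) : GenTree.tree nat :=
  match f with
  | FEq i j => GenTree.Node 0 [:: GenTree.Leaf i; GenTree.Leaf j]
  | FRel E t => GenTree.Node 1
      (GenTree.Leaf (enum_rank E : nat) :: map (@GenTree.Leaf nat) t)
  | FNot g => GenTree.Node 2 [:: code_form g]
  | FAnd g h => GenTree.Node 3 [:: code_form g; code_form h]
  | FEx i g => GenTree.Node 4 [:: GenTree.Leaf i; code_form g]
  end.

Lemma code_form_inj : injective code_form.
Proof.
elim=> [i j|E t|f IH|f IHf g IHg|i f IH] [i' j'|E' t'|f'|f' g'|i' f'] //=.
- by case=> -> ->.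
- case=> /val_inj/enum_rank_inj -> /inj_map -> // x y [] //.
- by case=> /IH ->.
- by case=> /IHf -> /IHg ->.
- by case=> -> /IH ->.
Qed.

(** Cantor's diagonal argument, run on the codes of the formulas. *)
Lemma no_injection (F : (nat -> bool) -> form L) : ~ injective F.
Proof.
move=> FI; pose c eta : nat := choice.pickle (code_form (F eta)).
have cI : injective c.
  by move=> x y /(pcan_inj (@choice.pickleK _))/code_form_inj/FI.
pose d n := `[< exists2 eta, c eta = n & ~~ eta n >].
case dd : (d (c d)).
  by case/asboolP: (dd) => eta /cI ->; rewrite dd.
by move/asboolP: (dd); apply; exists d; rewrite ?dd.
Qed.

End Countable.

(** * A model without atomic extension *)

Section Irrational.
Variables (L : finType) (ar : L -> nat) (R : realType) (alpha : L -> R).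
Hypothesis har : forall E, (2 <= ar E)%N.
Hypothesis hal : forall E, 0 < alpha E <= 1.

Lemma irrational_not_atomic (E0 : L) : ~ (exists q : rat, alpha E0 = ratr q) ->
  exists2 M : struc L, model_S ar alpha M & forall N : struc L,
    model_S ar alpha N -> atomic N -> ~ exists f : car M -> car N, embedding f.
Proof.
move=> irr; have /andP[a0 a1] := hal E0.
have alpha_ge0 E : 0 <= alpha E by have /andP[/ltW] := hal E.
have [s s0 small] := small_drops a0 a1 (har E0) irr.
pose good g := exists n D, minext ar alpha s n D g.
have sR : 0 < s%:R :> R by rewrite ltr0n.
have [rho [mult [rhoP mult_gt0 rho_sum rho_lim rho_inj]]] :=
  ladder (good := good) sR small.
have [nD hnD] : exists nD : R -> nat * (L -> {fset {fset pos}}), forall g, good g ->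
    minext ar alpha s (nD g).1 (nD g).2 g.
  suff /choice[nD h] : forall g : R, exists p : nat * (L -> {fset {fset pos}}),
    good g -> minext ar alpha s p.1 p.2 g by exists nD.
  move=> g; have [[n [D h]]|ng] := pselect (good g); first by exists (n, D).
  by exists (0%N, fun=> fset0).
pose nn g := (nD g).1; pose DD g := (nD g).2.
have rho_gt0 eta k : 0 < rho eta k := (rhoP eta k).1.
have rho_ext eta k : minext ar alpha s (nn (rho eta k)) (DD (rho eta k)) (rho eta k).
  exact: hnD (rhoP eta k).2.
have gF := fan_grounded mult rho_ext.
have hF := fan_hereditary s0 rho_gt0 rho_ext rho_sum.
have [J [fJ gJ hJ sJ]] := saturated_extension gF hF.
exists (domain ar J); first exact: domain_model.
move=> N HN HA [e He].
have [phi hphi] := choice (fun eta => HA s (base_val e eta)).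
apply: (@no_injection L phi) => eta nu pe.
(* The formula isolating the type of the base of [x] also holds at the base of [y], so the latter
   realises that type. *)
have key x y : phi x = phi y -> forall k, exists l, rho x k = rho y l.
  move=> xy; apply: (same_type alpha_ge0 s0 rho_gt0 rho_ext mult_gt0 rho_lim fJ gJ HN He).
  move=> psi ps hx; have [_ [_ h]] := hphi x; have [_ [hy _]] := hphi y.
  by apply: h hx _ _ => //; rewrite xy.
by apply: rho_inj; apply: key.
Qed.

End Irrational.

Theorem theorem5p27 (L : finType) (ar : L -> nat) (R : realType) (alpha : L -> R)
  (har : forall E : L, (2 <= ar E)%N)
  (hal : forall E : L, 0 < alpha E <= 1)
  (hnot : ~ (forall E : L, ar E = 2%N /\ alpha E = 1))
  (hcoh : coherent alpha) :
  rational_alpha alpha <->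
  (forall M : struc L, model_S ar alpha M ->
     exists N : struc L, model_S ar alpha N /\ atomic N /\
       exists f : car M -> car N, embedding f).
Proof.
split; first exact: rational_atomic.
move=> H E; apply: contrapT => irr.
have [M HM noN] := irrational_not_atomic har hal irr.
by have [N [HN [HA hf]]] := H M HM; apply: (noN N HN HA).
Qed.
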